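(* 1. $\{ z \in \mathbb{N} \mid L^B(\mathcal{T}_z) \text{ is countable}\}$ is $\Pi_1^1$-complete. 2. $\{ z \in \mathbb{N} \mid L^B(\mathcal{T}_z) \text{ is uncountable}\}$ is $\Sigma_1^1$-complete. 3. $\{ z \in \mathbb{N} \mid L^B(\mathcal{T}_z) \text{ is countably infinite}\}$ is $D_2(\Sigma_1^1)$-complete.
   Context: **Infinite pictures.** Let $\Sigma$ be a finite alphabet, $\#\notin\Sigma$ and $\hat{\Sigma}=\Sigma\cup\{\#\}$. An $\omega$-picture (infinite picture) over $\Sigma$ is a function $p:\omega\times\omega\to\hat{\Sigma}$ with $p(i,0)=p(0,i)=\#$ for all $i\ge 0$ and $p(i,j)\in\Sigma$ for all $i,j>0$. $\Sigma^{\omega,\omega}$ is the set of $\omega$-pictures over $\Sigma$. **Tiling systems.** A tiling system is a tuple $\mathcal{A}=(Q,\Sigma,\Delta)$ with $Q$ a finite set of states, $\Sigma$ a finite alphabet, and $\Delta\subseteq(\hat{\Sigma}\times Q)^4$ a finite set of tiles. A Büchi tiling system is a pair $(\mathcal{A},F)$ with $F\subseteq Q$. A run of $\mathcal{A}$ on $p\in\Sigma^{\omega,\omega}$ is a map $\rho:\omega\times\omega\to Q$ such that for all $(i,j)\in\omega\times\omega$ the tile $$\begin{pmatrix}(p(i,j+1),\rho(i,j+1)) & (p(i+1,j+1),\rho(i+1,j+1))\\ (p(i,j),\rho(i,j)) & (p(i+1,j),\rho(i+1,j))\end{pmatrix}$$ belongs to $\Delta$. The run is accepting if $\rho(v)\in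 F$ for infinitely many $v\in\omega^2$. $L^B((\mathcal{A},F))$ is the set of $p\in\Sigma^{\omega,\omega}$ having an accepting run. **Indexing.** $\Sigma=\{a,b\}$ and $\mathcal{T}_z$ denotes the (non deterministic) Büchi tiling system of index $z\in\mathbb{N}$ over $\{a,b\}$, in a fixed effective enumeration of all Büchi tiling systems over $\{a,b\}$. **Classes and completeness.** ''Countable'' means finite or countably infinite. $\Sigma^1_1,\Pi^1_1$ are the (lightface) classes of the first level of the analytical hierarchy of subsets of $\mathbb{N}$. $D_2(\Sigma^1_1)$ is the class of $2$-differences of $\Sigma^1_1$-sets, i.e. of sets that are the intersection of a $\Sigma^1_1$-set and a $\Pi^1_1$-set. For $A,B\subseteq\mathbb{N}$, $A\le_1 B$ means that there is a total computable injective $f:\mathbb{N}\to\mathbb{N}$ with $A=f^{-1}[B]$. For a class $\Gamma$ among these, $A\subseteq\mathbb{N}$ is $\Gamma$-complete if $A\in\Gamma$ and $B\le_1 A$ for every $B\subseteq\mathbb{N}$ in $\Gamma$. *)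

(* Defs.v *)
From HB Require Import structures.
From mathcomp Require Import all_boot.
From mathcomp Require Import mathcomp_extra boolp classical_sets functions.
From mathcomp Require Import cardinality.

Set Implicit Arguments.
Unset Strict Implicit.
Unset Printing Implicit Defensive.

Local Open Scope classical_set_scope.

(* [Sigma^] is [option Sigma], the border symbol # being [None]. *)
Definition is_picture (Sigma : finType) (p : nat * nat -> option Sigma) : Prop :=
  forall i j, (p (i, j) == None) = (i == 0) || (j == 0).

(* The components of a tile are listed in the order
   top left, top right, bottom left, bottom right. *)
Definition tile (Sigma Q : Type) : Type :=
  (option Sigma * Q) * (option Sigma * Q) *
  (option Sigma * Q) * (option Sigma * Q).

Record buchi_tiling_system (Sigma : finType) := BuchiTilingSystem {
  state : finType;
  tiles : pred (tile Sigma state);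
  final : pred state
}.

Definition is_run (Sigma : finType) (A : buchi_tiling_system Sigma)
    (p : nat * nat -> option Sigma) (rho : nat * nat -> state A) : Prop :=
  forall i j,
    tiles ((p (i, j.+1), rho (i, j.+1)), (p (i.+1, j.+1), rho (i.+1, j.+1)),
           (p (i, j), rho (i, j)), (p (i.+1, j), rho (i.+1, j))).

Definition is_accepting (Sigma : finType) (A : buchi_tiling_system Sigma)
    (rho : nat * nat -> state A) : Prop :=
  infinite_set [set v | final (rho v)].

Definition buchi_language (Sigma : finType) (A : buchi_tiling_system Sigma) :
    set (nat * nat -> option Sigma) :=
  [set p | is_picture p /\
           exists rho : nat * nat -> state A, is_run p rho /\ is_accepting rho].

(* The alphabet {a, b} is [bool]. *)
Definition symbol_code (c : option bool) : nat :=
  match c with None => 0 | Some false => 1 | Some true => 2 end.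

Definition tile_code (n : nat) (t : tile bool 'I_n) : nat :=
  let: (x1, x2, x3, x4) := t in
  CodeSeq.code [:: symbol_code x1.1; val x1.2; symbol_code x2.1; val x2.2;
                   symbol_code x3.1; val x3.2; symbol_code x4.1; val x4.2].

(* [CodeSeq.decode] is a computable bijection from [nat] onto [seq nat].  The
   index [z] is decoded as [:: n; f, c_1, ..., c_k]: the states are those of
   ['I_n], [f] codes the list of final states, and the [c_i] are the codes of
   the tiles.  Missing entries default to 0, and out-of-range ones are ignored,
   so that every [z] is an index. *)
Definition tiling_of_index (z : nat) : buchi_tiling_system bool :=
  let s := CodeSeq.decode z in
  let n := nth 0 s 0 in
  @BuchiTilingSystem bool 'I_n
    (fun t => tile_code t \in drop 2 s)
    (fun q => val q \in CodeSeq.decode (nth 0 s 1)).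

Definition tile_map (Sigma Q Q' : Type) (h : Q -> Q') (t : tile Sigma Q) :
    tile Sigma Q' :=
  let: (x1, x2, x3, x4) := t in
  ((x1.1, h x1.2), (x2.1, h x2.2), (x3.1, h x3.2), (x4.1, h x4.2)).

Lemma symbol_code_inj : injective symbol_code.
Proof. by move=> [[]|] [[]|]. Qed.

Lemma tile_code_inj (n : nat) : injective (@tile_code n).
Proof.
move=> [[[[a1 q1] [a2 q2]] [a3 q3]] [a4 q4]] [[[[b1 r1] [b2 r2]] [b3 r3]] [b4 r4]].
move=> /(can_inj CodeSeq.codeK) [].
move=> /symbol_code_inj -> /val_inj -> /symbol_code_inj -> /val_inj ->.
by move=> /symbol_code_inj -> /val_inj -> /symbol_code_inj -> /val_inj ->.
Qed.

(* Up to a renaming of the states, every Buechi tiling system has an index. *)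
Lemma tiling_of_index_surj (A : buchi_tiling_system bool) :
  exists z (h : state A -> state (tiling_of_index z)),
    [/\ bijective h,
        forall t, tiles (tile_map h t) = tiles t &
        forall q, final (h q) = final q].
Proof.
pose n := #|state A|.
pose h (q : state A) : 'I_n := enum_rank q.
pose g (q : 'I_n) : state A := enum_val q.
pose ts := [seq tile_code (tile_map h t) |
             t <- enum (@tiles _ A : pred _)].
pose fs := [seq val (h q) | q <- enum (@final _ A : pred _)].
pose s := [:: n, CodeSeq.code fs & ts].
have hK : cancel h g by exact: enum_rankK.
have gK : cancel g h by exact: enum_valK.
have hinj : injective h := can_inj hK.
have tinj : injective (@tile_map bool _ _ h).
  move=> [[[[a1 q1] [a2 q2]] [a3 q3]] [a4 q4]].
  move=> [[[[b1 r1] [b2 r2]] [b3 r3]] [b4 r4]] /= [].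
  by do 4![move=> -> /hinj ->].
exists (CodeSeq.code s); rewrite /tiling_of_index CodeSeq.codeK /=.
exists h; split; first by exists g.
- move=> t; rewrite drop0; set c := fun t => tile_code (tile_map h t).
  have c_inj : injective c by move=> t1 t2 /tile_code_inj /tinj.
  by rewrite -[LHS]/(c t \in map c _) (mem_map c_inj) mem_enum.
- move=> q; rewrite CodeSeq.codeK; set c := fun q => val (h q).
  have c_inj : injective c by move=> q1 q2 /val_inj /hinj.
  by rewrite -[LHS]/(c q \in map c _) (mem_map c_inj) mem_enum.
Qed.

(* [recfun k]: descriptions of the k-ary partial recursive functions. *)
Inductive recfun : nat -> Type :=
| rf_zero : recfun 0
| rf_succ : recfun 1
| rf_proj (k : nat) (i : 'I_k) : recfun k
| rf_comp (k m : nat) (g : recfun m) (hs : 'I_m -> recfun k) : recfun k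
| rf_prec (k : nat) (g : recfun k) (h : recfun k.+2) : recfun k.+1
| rf_mu (k : nat) (g : recfun k.+1) : recfun k.

(* [rf_eval f v y]: the computation of [f] on [v] halts with value [y].
   Primitive recursion: f (0, w) = g w and f (i + 1, w) = h (i, f (i, w), w),
   [u] being the sequence of the successive values. *)
Fixpoint rf_eval (k : nat) (f : recfun k) : k.-tuple nat -> nat -> Prop :=
  match f in recfun k return k.-tuple nat -> nat -> Prop with
  | rf_zero => fun _ y => y = 0
  | rf_succ => fun v y => y = (thead v).+1
  | rf_proj _ i => fun v y => y = tnth v i
  | rf_comp _ m g hs => fun v y =>
      exists w : m.-tuple nat,
        (forall i, rf_eval (hs i) v (tnth w i)) /\ rf_eval g w y
  | rf_prec _ g h => fun v y =>
      exists u : nat -> nat,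
        [/\ rf_eval g [tuple of behead v] (u 0),
            forall i, i < thead v ->
              rf_eval h [tuple of [:: i, u i & behead v]] (u i.+1) &
            y = u (thead v)]
  | rf_mu _ g => fun v y =>
      rf_eval g [tuple of y :: v] 0 /\
      forall i, i < y -> exists c, rf_eval g [tuple of i :: v] c.+1
  end.

Definition computable (f : nat -> nat) : Prop :=
  exists c : recfun 1, forall n, rf_eval c [tuple n] (f n).

Definition one_reducible (A B : set nat) : Prop :=
  exists f : nat -> nat, [/\ computable f, injective f & A = f @^-1` B].

Definition complete_for (Gamma : set (set nat)) (A : set nat) : Prop :=
  Gamma A /\ forall B : set nat, Gamma B -> one_reducible B A.

(* Arithmetical formulas (number quantifiers only) in the language of
   second-order arithmetic, with [k] free function variables; number variables
   are de Bruijn indices. *)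
Inductive term (k : nat) : Type :=
| t_var (x : nat)
| t_zero
| t_succ (t : term k)
| t_add (t u : term k)
| t_mul (t u : term k)
| t_app (i : 'I_k) (t : term k).

Inductive formula (k : nat) : Type :=
| f_eq (t u : term k)
| f_lt (t u : term k)
| f_not (phi : formula k)
| f_and (phi psi : formula k)
| f_ex (phi : formula k).

Fixpoint term_eval (k : nat) (F : 'I_k -> nat -> nat) (e : seq nat)
    (t : term k) : nat :=
  match t with
  | t_var x => nth 0 e x
  | t_zero => 0
  | t_succ t => (term_eval F e t).+1
  | t_add t u => term_eval F e t + term_eval F e u
  | t_mul t u => term_eval F e t * term_eval F e u
  | t_app i t => F i (term_eval F e t)
  end.

Fixpoint holds (k : nat) (F : 'I_k -> nat -> nat) (e : seq nat)
    (phi : formula k) : Prop :=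
  match phi with
  | f_eq t u => term_eval F e t = term_eval F e u
  | f_lt t u => term_eval F e t < term_eval F e u
  | f_not phi => ~ holds F e phi
  | f_and phi psi => holds F e phi /\ holds F e psi
  | f_ex phi => exists m : nat, holds F (m :: e) phi
  end.

(* Lightface: the formula has no parameters, [n] being the value of its only
   free number variable (any other free index denotes 0). *)
Definition Sigma11 : set (set nat) :=
  [set A | exists (k : nat) (phi : formula k), forall n : nat,
     A n <-> exists F : 'I_k -> nat -> nat, holds F [:: n] phi].

Definition Pi11 : set (set nat) := [set A | Sigma11 (~` A)].

Definition D2_Sigma11 : set (set nat) :=
  [set A | exists B C, [/\ Sigma11 B, Pi11 C & A = B `&` C]].

(* Main.v *)
(* Upper bounds.  The accepting runs over a system, completed by witnesses of
   acceptance, form a closed set of sequences, of which the language is a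
   continuous image.  By a Cantor-Bendixson argument the image is uncountable
   iff there is a nonempty countable family of points in which every point is a
   limit of points with a different image.  This, like the existence of
   infinitely many distinct pictures, is Sigma11.

   Hardness.  Tabulating terms, truth values and Skolem functions brings a
   Sigma11 set into the form: there are unary functions satisfying, for all x, a
   positive combination of equations between terms built from x, n, 0, successor
   and the functions.  A nondeterministic program with finitely many registers,
   the functions being read on infinite tapes, checks the clauses for x = 0, 1,
   2, ... in turn and flashes after each success: n is in the set iff, for some
   tapes, some run flashes infinitely often.  Row t + 1 of a tiling is the
   configuration at time t, and n is given by a countdown of length n + 2 in the
   bottom row.  None of this constrains the letters of the picture.  Given two
   sets A1 and A2, the system guesses for which one it runs the program, and in
   the second case requires the rows of b's to form an initial segment; its
   language consists of all pictures if n is in A1, of countably infinitely many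
   ones if n is only in A2, and is empty otherwise. *)
Require Import Defs.
From mathcomp Require Import all_boot.
From mathcomp Require Import mathcomp_extra boolp classical_sets functions.
From mathcomp Require Import cardinality.
From mathcomp Require Import zify.

Set Implicit Arguments.
Unset Strict Implicit.
Unset Printing Implicit Defensive.

Local Open Scope classical_set_scope.

(** * Dense families in analytic sets *)

Lemma countableU (U : Type) (A B : set U) :
  countable A -> countable B -> countable (A `|` B).
Proof.
move=> cA cB; rewrite -(bigcup2E A B); apply: bigcup_countable => //.
by move=> [|[|i]] _ //=; exact: countable0.
Qed.

Lemma countable_enum (U : Type) (A : set U) (x0 : U) :
  countable A -> exists g : nat -> U, forall x, A x -> exists k, g k = x.
Proof.
move=> /countable_injP[f finj].
have g k : {x | forall x', A x' -> f x' = k -> x' = x}.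
  apply: cid; have [[x [Ax fx]]|nx] := pselect (exists x, A x /\ f x = k).
    exists x => x' Ax' fx'; apply: finj; rewrite ?inE //.
    by rewrite fx.
  by exists x0 => x' Ax' fx'; case: nx; exists x'.
exists (fun k => sval (g k)) => x Ax; exists (f x).
exact: esym (svalP (g (f x)) x Ax erefl).
Qed.

Section Condensation.
Variables (I T : countType).
Implicit Types (x y : I -> T) (C : set (I -> T)).

(** Basic neighbourhoods of the product of discrete spaces [I -> T], the coordinates being ordered
    by [pickle]. *)
Definition agree (l : nat) x y := forall i, pickle i < l -> x i = y i.

Lemma agree_trans l x y z : agree l x y -> agree l y z -> agree l x z.
Proof. by move=> xy yz i li; rewrite xy // yz. Qed.

Lemma agree_le k l x y : k <= l -> agree l x y -> agree k x y.
Proof. by move=> kl xy i ik; rewrite xy // (leq_trans ik). Qed.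

Definition prefix_of l x : seq (option T) :=
  [seq omap x (@unpickle I c) | c <- iota 0 l].

Lemma prefix_ofP l x y : prefix_of l x = prefix_of l y -> agree l x y.
Proof.
move=> /eq_in_map xy i li; have := xy (pickle i).
by rewrite mem_iota /= add0n li pickleK => /(_ isT) [].
Qed.

(* Cantor-Bendixson: discard the points having a neighbourhood whose image
   is countable; countably many neighbourhoods account for all of them. *)
Lemma dense_family (U : Type) (C : set (I -> T)) (pr : (I -> T) -> U) :
  ~ countable (pr @` C) ->
  exists D : nat -> I -> T, (forall m, C (D m)) /\
    forall m l, exists m', agree l (D m) (D m') /\ pr (D m') <> pr (D m).
Proof.
move=> uncC.
pose N l y : set (I -> T) := [set y' | C y' /\ agree l y y'].
pose C' : set (I -> T) := [set y | C y /\ forall l, ~ countable (pr @` N l y)].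
pose Nw (w : seq (option T)) : set (I -> T) :=
  [set y | C y /\ exists l, prefix_of l y = w].
have cD : countable (pr @` (C `\` C')).
  pose W : set (seq (option T)) :=
    [set w | exists2 y, countable (pr @` N (size w) y) & prefix_of (size w) y = w].
  have sub : pr @` (C `\` C') `<=`
      \bigcup_(w in W) (pr @` [set y | C y /\ prefix_of (size w) y = w]).
    move=> _ [y [Cy C'y] <-].
    have [l cl] : exists l, countable (pr @` N l y).
      by apply: contrapT => ncl; apply: C'y; split=> // l cl; apply: ncl; exists l.
    have szl : size (prefix_of l y) = l by rewrite size_map size_iota.
    exists (prefix_of l y); first by exists y; rewrite szl.
    by exists y => //; split=> //; rewrite szl.
  apply: sub_countable (subset_card_le sub) _; apply: bigcup_countable.
    exact: countableP.
  move=> w [y cy yw]; apply: sub_countable (subset_card_le _) cy.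
  by apply: image_subset => z [Cz zw]; split=> //; apply: prefix_ofP; rewrite yw.
have [y0 C'y0] : exists y, C' y.
  apply: contrapT => nC'; apply: uncC.
  apply: sub_countable (subset_card_le _) cD.
  by apply: image_subset => y Cy; split=> // C'y; apply: nC'; exists y.
have next y l : {y' | C' y -> [/\ C' y', agree l y y' & pr y' <> pr y]}.
  apply: cid; have [C'y|nC'y] := pselect (C' y); last by exists y.
  apply: contrapT => nex; case: (C'y) => Cy /(_ l); apply.
  (* Without such a [y'], every image near [y] would be [pr y] or the image of a discarded point, so
     there would be countably many. *)
  apply: (@sub_countable _ _ _ ([set pr y] `|` pr @` (C `\` C'))); last first.
    by apply: countableU => //; exact: countable1.
  apply: subset_card_le => _ [z [Cz yz] <-].
  have [C'z|nC'z] := pselect (C' z); last by right; exists z.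
  left; apply: contrapT => /= zy; apply: nex; exists z => _; split=> //.
(* The points reached from [y0] are indexed by finite lists of precisions, so a countable family is
   closed under [next]. *)
pose G := foldr (fun l y => sval (next y l)) y0.
have C'G s : C' (G s).
  by elim: s => //= l s IH; have [] := svalP (next (G s) l) IH.
exists (fun m => G (odflt [::] (@unpickle (seq nat) m))).
split=> [m|m l]; first by case: (C'G (odflt [::] (unpickle m))).
set s := odflt _ _; exists (pickle (l :: s)); rewrite pickleK /=.
by have [] := svalP (next (G s) l) (C'G s).
Qed.

(** Diagonalization: against an enumeration [g] of the image, nested neighbourhoods are chosen so
    that the [k]-th choice excludes [g k]. Closedness keeps the limit point in [C], and [g] misses
    its image. *)
Lemma dense_family_uncountable (V W : Type) (C : set (I -> T))
    (pr : (I -> T) -> V -> W) (D : nat -> I -> T) :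
  (forall y, (forall l, exists2 y', C y' & agree l y' y) -> C y) ->
  (forall v, exists l, forall y y', agree l y y' -> pr y v = pr y' v) ->
  (forall m, C (D m)) ->
  (forall m l, exists m', agree l (D m) (D m') /\ pr (D m') <> pr (D m)) ->
  ~ countable (pr @` C).
Proof.
move=> clC cpr CD dD /(countable_enum (pr (D 0)))[g gP].
have step k (c : nat * nat) : {c' : nat * nat | [/\ agree c.2 (D c.1) (D c'.1),
    c.2 < c'.2 & forall y, agree c'.2 (D c'.1) y -> pr y <> g k]}.
  apply: cid; case: c => m l /=.
  (* [D m] and a nearby [D m1] have different images, so one of them avoids [g k]. *)
  have [m' [mm' dm']] : exists m', agree l (D m) (D m') /\ pr (D m') <> g k.
    have [m1 [mm1 dm1]] := dD m l.
    have [e|ne] := pselect (pr (D m) = g k); last by exists m.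
    by exists m1; rewrite -e.
  have [v dv] : exists v, pr (D m') v <> g k v.
    by apply: contrapT => nv; apply: dm'; apply/funext => v;
       apply: contrapT => dv; apply: nv; exists v.
  have [lv lvP] := cpr v.
  (* The coordinates below [lv] fix the value at [v], where the image differs from [g k]; [l.+1]
     makes the radii grow. *)
  exists (m', maxn l.+1 lv) => /=; split=> //; first by rewrite leq_maxl.
  move=> y /(agree_le (leq_maxr _ _)) /lvP ey e; apply: dv.
  by rewrite ey e.
pose c := fix c k := if k is k'.+1 then sval (step k' (c k')) else (0, 0).
have cS k : [/\ agree (c k).2 (D (c k).1) (D (c k.+1).1),
    (c k).2 < (c k.+1).2 &
    forall y, agree (c k.+1).2 (D (c k.+1).1) y -> pr y <> g k].
  exact: (svalP (step k (c k))).
have lk k : k <= (c k).2.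
  by elim: k => // k IH; have [_ lt _] := cS k; exact: leq_ltn_trans lt.
have cD k d : (c k).2 <= (c (k + d)).2 /\
    agree (c k).2 (D (c k).1) (D (c (k + d)).1).
  elim: d => [|d [le IH]]; first by rewrite addn0.
  rewrite addnS; have [ag lt _] := cS (k + d).
  split; first exact: leq_trans (ltnW lt).
  exact: agree_trans IH (agree_le le ag).
(* Coordinate [i] is settled at stage [(pickle i).+1], whose radius exceeds [pickle i]. *)
pose y i := D (c (pickle i).+1).1 i.
have yP k : agree (c k).2 (D (c k).1) y.
  move=> i ik; rewrite /y; have [ik'|/ltnW ik'] := leqP k (pickle i).+1.
    by have [_ ->] := cD k ((pickle i).+1 - k); rewrite ?subnKC.
  have [_ ->] := cD (pickle i).+1 (k - (pickle i).+1); rewrite ?subnKC //.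
have /gP [k gk] : (pr @` C) (pr y).
  exists y => //; apply: clC => l; exists (D (c l).1) => //.
  exact: agree_le (lk l) (yP l).
by have [_ _ /(_ y (yP k.+1))] := cS k; rewrite gk.
Qed.
End Condensation.

(** * Arithmetical definability *)

Section Definability.
Variables (k : nat) (F : 'I_k -> nat -> nat).
Implicit Types (p q : formula k) (P Q : Prop) (e : seq nat).

Definition f_or p q := f_not (f_and (f_not p) (f_not q)).
Definition f_imp p q := f_not (f_and p (f_not q)).
Definition f_all p := f_not (f_ex (f_not p)).

Lemma holds_not e p P : (holds F e p <-> P) -> (holds F e (f_not p) <-> ~ P).
Proof. by move=> /= ->. Qed.

Lemma holds_and e p q P Q : (holds F e p <-> P) -> (holds F e q <-> Q) ->
  (holds F e (f_and p q) <-> P /\ Q).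
Proof. by move=> /= -> ->. Qed.

Lemma holds_or e p q P Q : (holds F e p <-> P) -> (holds F e q <-> Q) ->
  (holds F e (f_or p q) <-> P \/ Q).
Proof.
move=> /= -> ->; split=> [nPQ|[p0 []|q0 []]] //.
by apply: contrapT => /not_orP.
Qed.

Lemma holds_imp e p q P Q : (holds F e p <-> P) -> (holds F e q <-> Q) ->
  (holds F e (f_imp p q) <-> (P -> Q)).
Proof.
move=> /= -> ->; split=> [nPQ p0|PQ [/PQ]] //.
by apply: contrapT => nQ; apply: nPQ.
Qed.

Lemma holds_ex e p (P : nat -> Prop) :
  (forall m, holds F (m :: e) p <-> P m) ->
  (holds F e (f_ex p) <-> exists m, P m).
Proof. by move=> pP; split=> -[m /pP Pm]; exists m => //; apply/pP. Qed.

Lemma holds_all e p (P : nat -> Prop) :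
  (forall m, holds F (m :: e) p <-> P m) ->
  (holds F e (f_all p) <-> forall m, P m).
Proof.
move=> pP; split=> /= [nP m|Pm [m]]; last by apply; apply/pP.
by apply: contrapT => nPm; apply: nP; exists m => /pP.
Qed.

End Definability.

Ltac holds_iff := repeat first
  [ apply: holds_or | apply: holds_imp | apply: holds_all => ?
  | apply: holds_and | apply: holds_ex => ? | apply: holds_not
  | exact: iff_refl ].

(* A polynomial, hence definable, injective pairing. *)
Definition pr (x y : nat) := (x + y) * (x + y) + x.

Lemma pr_inj x y x' y' : pr x y = pr x' y' -> x = x' /\ y = y'.
Proof.
suff sle a b c d : pr a b = pr c d -> a + b <= c + d.
  move=> e; have s := sle _ _ _ _ e; have s' := sle _ _ _ _ (esym e).
  have E : x + y = x' + y' by lia.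
  by move: e; rewrite /pr E; lia.
rewrite /pr => e; rewrite leqNgt; apply/negP => lt.
by have := leq_mul lt lt; lia.
Qed.

(** [pr] is injective but not onto, hence the default [t] off its range. This lets unary function
    variables carry functions of several arguments. *)
Lemma pr_lift (T : Type) (t : T) (g : nat -> nat -> T) :
  exists G : nat -> T, forall x y, G (pr x y) = g x y.
Proof.
have G c : {t : T | forall x y, c = pr x y -> t = g x y}.
  apply: cid; have [[x [y ->]]|nc] := pselect (exists x y, c = pr x y).
    by exists (g x y) => x' y' /pr_inj[-> ->].
  by exists t => x y cxy; case: nc; exists x, y.
by exists (fun c => sval (G c)) => x y; exact: (svalP (G (pr x y)) x y erefl).
Qed.

(** * Arithmetic description of the coding of lists *)

Section IndexArithmetic.
Variable E : nat -> nat.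

(** Terms have no exponentiation, so the powers of 2 in [CodeSeq.code] enter through one more
    quantified function, pinned down by its recursion. *)
Definition exp2_spec := E 0 = 1 /\ forall x, E x.+1 = E x + E x.

Definition acons (n m : nat) := E n * (m + m).+1.

(* [Z i] is the code of the [i]-th suffix of the list coded by [c], and [H i]
   is its head. *)
Definition list_spec (c : nat) (Z H : nat -> nat) :=
  Z 0 = c /\ forall i,
    (Z i = 0 /\ Z i.+1 = 0 /\ H i = 0) \/ Z i = acons (H i) (Z i.+1).

Lemma exp2P x : exp2_spec -> E x = 2 ^ x.
Proof.
by move=> [E0 ES]; elim: x => // x IH; rewrite ES IH expnS mul2n addnn.
Qed.

Lemma aconsP n m : exp2_spec -> acons n m = CodeSeq.code (n :: CodeSeq.decode m).
Proof. by move=> /exp2P e; rewrite /acons /= CodeSeq.decodeK e addnn. Qed.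

Lemma list_spec_drop c Z H i : exp2_spec -> list_spec c Z H ->
  CodeSeq.decode (Z i) = drop i (CodeSeq.decode c).
Proof.
move=> hE [Z0 ZS]; elim: i => [|i IH]; first by rewrite drop0 Z0.
rewrite -addn1 addnC -drop_drop -IH.
have [[-> [-> _]]|->] := ZS i; first by [].
by rewrite aconsP // CodeSeq.codeK /= drop0.
Qed.

Lemma list_spec_nth c Z H i : exp2_spec -> list_spec c Z H ->
  H i = nth 0 (CodeSeq.decode c) i.
Proof.
move=> hE hZ; have := list_spec_drop i hE hZ; case: hZ => [_ /(_ i)].
rewrite -[i in nth _ _ i]addn0 -nth_drop.
move=> [[-> [_ ->]] <- //|-> <-]; by rewrite aconsP // CodeSeq.codeK.
Qed.

Lemma list_spec_mem c Z H d n : exp2_spec -> list_spec c Z H ->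
  (n \in drop d (CodeSeq.decode c)) <-> exists i, 0 < Z (i + d) /\ H (i + d) = n.
Proof.
move=> hE hZ.
have Z_gt0 i : (0 < Z i) = (i < size (CodeSeq.decode c)).
  rewrite -[RHS]subn_gt0 -size_drop -(list_spec_drop i hE hZ).
  by rewrite -[in LHS](CodeSeq.decodeK (Z i)); case: (CodeSeq.decode _) => //= ? ?;
     rewrite muln_gt0 expn_gt0.
split=> [/(nthP 0)[i]|[i []]].
  rewrite size_drop ltn_subRL nth_drop addnC => lti <-; exists i.
  by rewrite Z_gt0 lti (list_spec_nth _ hE hZ).
rewrite Z_gt0 (list_spec_nth _ hE hZ) => lti <-; rewrite addnC -nth_drop.
by apply: mem_nth; rewrite size_drop ltn_subRL addnC.
Qed.

Lemma list_spec_ex c : exp2_spec -> exists Z H, list_spec c Z H.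
Proof.
move=> hE; exists (fun i => CodeSeq.code (drop i (CodeSeq.decode c))).
exists (nth 0 (CodeSeq.decode c)); split; first by rewrite drop0 CodeSeq.decodeK.
move=> i; have [lti|] := ltnP i (size (CodeSeq.decode c)).
  by right; rewrite aconsP // CodeSeq.codeK -drop_nth.
by left; rewrite !drop_oversize ?nth_default // leqW.
Qed.

End IndexArithmetic.

Lemma exp2_ex : exists E, exp2_spec E.
Proof. by exists (expn 2); split=> // x; rewrite expnS mul2n addnn. Qed.

(** * Accepting runs of the system of a given index *)

Lemma unbounded_infinite (T : choiceType) (r : T -> nat) (A : set T) :
  (forall i, exists v, A v /\ i <= r v) -> infinite_set A.
Proof.
move=> unb /finite_seqP[s As].
have [v [Av]] := unb (\max_(v <- s) r v).+1.
rewrite ltnNge => /negP; apply; apply: leq_bigmax_seq => //.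
by move: Av; rewrite As.
Qed.

Lemma infinite_unbounded (T : Type) (r : T -> nat) (A : set T) :
  (forall i, finite_set (A `&` [set v | r v < i])) ->
  infinite_set A -> forall i, exists v, A v /\ i <= r v.
Proof.
move=> fin infA i; apply: contrapT => nex; apply: infA.
apply: sub_finite_set (fin i) => v Av; split=> //=.
by rewrite ltnNge; apply/negP => iv; apply: nex; exists v.
Qed.

Section AcceptedPoints.
Variable z : nat.
Local Notation n := (nth 0 (CodeSeq.decode z) 0).
Local Notation A := (tiling_of_index z).

(** Picture, run and witnesses are packed into one function on the cells, so that the condensation
    lemmas apply with [pic] as the projection; witness [i] is stored in the cell [(i, 0)]. *)
Definition run_point := (nat * nat -> option bool * 'I_n * nat)%type.
Implicit Types (y : run_point) (D : nat -> run_point).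

Definition pic y v := (y v).1.1.
Definition run y v : state A := (y v).1.2.
Definition wit y i := (y (i, 0)).2.

(* The witnesses [wit y i >= i] make the set of accepting runs closed. *)
Definition accepted : set run_point := [set y |
  [/\ is_picture (pic y), is_run (pic y) (run y) &
      forall i, exists x j,
        [/\ wit y i = pr x j, i <= wit y i & final (run y (x, j))]]].

Lemma accepted_language : pic @` accepted = buchi_language A.
Proof.
rewrite eqEsubset; split=> [_ [y [py ry wy] <-]|p [pp [rho [rrho arho]]]].
  split=> //; exists (run y); split=> //.
  apply: (@unbounded_infinite _ (fun v => pr v.1 v.2)) => i.
  by have [x [j [e le f]]] := wy i; exists (x, j); rewrite -e.
have /(_ _) /cid wit_ex i : exists v, final (rho v) /\ i <= pr v.1 v.2.
  apply: (infinite_unbounded _ arho) => {}i.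
  apply: (@sub_finite_set _ _ (`I_i `*` `I_i)); last first.
    exact: finite_setX.
  by move=> [x j] [_ /=]; rewrite /pr; nia.
pose y v := (p v, rho v, let v' := sval (wit_ex v.1) in pr v'.1 v'.2).
exists (y : run_point); last by [].
split=> // i; exists (sval (wit_ex i)).1, (sval (wit_ex i)).2.
by have [f le] := svalP (wit_ex i); split; rewrite -?surjective_pairing.
Qed.

Lemma pickle_bound (T : countType) (s : seq T) :
  exists l, forall x, x \in s -> pickle x < l.
Proof.
exists (\max_(x <- s) pickle x).+1 => x xs.
by rewrite ltnS; apply: leq_bigmax_seq.
Qed.

Lemma accepted_closed y :
  (forall l, exists2 y', accepted y' & agree l y' y) -> accepted y.
Proof.
move=> cly.
have close (s : seq (nat * nat)) : exists2 y', accepted y' & {in s, y' =1 y}.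
  have [l lP] := pickle_bound s.
  by have [y' ay' yy'] := cly l; exists y' => // v /lP /yy'.
split.
- move=> i j; have [y' [py' _ _] e] := close [:: (i, j)].
  by rewrite -py' /pic e // mem_head.
- move=> i j; have [y' [_ ry' _] e] :=
    close [:: (i, j); (i.+1, j); (i, j.+1); (i.+1, j.+1)].
  by have := ry' i j; rewrite /pic /run !e ?inE ?eqxx ?orbT.
- move=> i; have [y' [_ _ wy'] e] := close [:: (i, 0)].
  have [x [j []]] := wy' i; rewrite /wit e ?mem_head // => yx le _.
  exists x, j; split=> //.
  (* The cell [(x, j)] is known only once the witness is read; a second approximation, agreeing at
     that cell too, shows that its state is final. *)
  have [y'' [_ _ wy''] e'] := close [:: (i, 0); (x, j)].
  have [x' [j' []]] := wy'' i.
  rewrite /wit e' ?mem_head // yx => /pr_inj[<- <-] _.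
  by rewrite /run e' // !inE eqxx orbT.
Qed.

(** Function variables of formulas are unary, so a whole family of points is tabulated by three
    functions through [pr]. *)
Definition represents D (P R W : nat -> nat) := forall m,
  (forall i j, P (pr m (pr i j)) = symbol_code (pic (D m) (i, j)) /\
               R (pr m (pr i j)) = val (run (D m) (i, j))) /\
  forall i, W (pr m i) = wit (D m) i.

Lemma represents_ex D : exists P R W, represents D P R W.
Proof.
have lift3 (g : nat -> nat -> nat -> nat) :
    exists G, forall m i j, G (pr m (pr i j)) = g m i j.
  have /choice[h hP] m : exists h : nat -> nat, forall i j, h (pr i j) = g m i j.
    exact: (pr_lift 0).
  have [G GP] := pr_lift 0 h.
  by exists G => m i j; rewrite GP hP.
have [P hP] := lift3 (fun m i j => symbol_code (pic (D m) (i, j))).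
have [R hR] := lift3 (fun m i j => val (run (D m) (i, j))).
have [W hW] := pr_lift 0 (fun m i => wit (D m) i).
by exists P, R, W => m; split=> [i j|i]; rewrite ?hP ?hR ?hW.
Qed.

Variables (E Z H Z' H' : nat -> nat).

Definition acode (P R : nat -> nat) m i j :=
  acons E (P (pr m (pr i j.+1))) (acons E (R (pr m (pr i j.+1)))
  (acons E (P (pr m (pr i.+1 j.+1))) (acons E (R (pr m (pr i.+1 j.+1)))
  (acons E (P (pr m (pr i j))) (acons E (R (pr m (pr i j)))
  (acons E (P (pr m (pr i.+1 j))) (acons E (R (pr m (pr i.+1 j))) 0))))))).

(** This and the following specifications copy the shape of the formulas below, so that [holds_iff]
    can descend through both in parallel. *)
Definition picture_spec P := forall m i j : nat,
  P (pr m (pr i j)) < 3 /\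
  ((P (pr m (pr i j)) = 0 /\ (i = 0 \/ j = 0)) \/
   (0 < P (pr m (pr i j)) /\ ~ (i = 0 \/ j = 0))).

(** The shift by 2 skips the number of states and the code of the final states, which precede the
    tiles in an index; [0 < Z c.+2] says that the position lies inside the list. *)
Definition run_spec P R := forall m i j : nat,
  R (pr m (pr i j)) < H 0 /\
  exists c, 0 < Z c.+2 /\ H c.+2 = acode P R m i j.

Definition wit_spec R W := forall m i : nat,
  exists x j, W (pr m i) = pr x j /\ (i < (W (pr m i)).+1 /\
    exists c, 0 < Z' c /\ H' c = R (pr m (pr x j))).

Definition family_spec P R W := picture_spec P /\ run_spec P R /\ wit_spec R W.

Hypotheses (hE : exp2_spec E) (hZ : list_spec E z Z H)
  (hZ' : list_spec E (H 1) Z' H').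

Lemma H0E : H 0 = n. Proof. exact: list_spec_nth hE hZ. Qed.

Lemma family_specP D P R W : represents D P R W ->
  (forall m, accepted (D m)) <-> family_spec P R W.
Proof.
move=> rep.
have repP m i j : P (pr m (pr i j)) = symbol_code (pic (D m) (i, j)).
  by case: (rep m) => /(_ i j)[].
have repR m i j : R (pr m (pr i j)) = val (run (D m) (i, j)).
  by case: (rep m) => /(_ i j)[].
have repW m i : W (pr m i) = wit (D m) i by case: (rep m).
have codeE m i j : acode P R m i j = tile_code
    ((pic (D m) (i, j.+1), run (D m) (i, j.+1)),
     (pic (D m) (i.+1, j.+1), run (D m) (i.+1, j.+1)),
     (pic (D m) (i, j), run (D m) (i, j)),
     (pic (D m) (i.+1, j), run (D m) (i.+1, j))).
  by rewrite /acode !aconsP // !CodeSeq.codeK !repP !repR.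
have finE (q : 'I_n) : final (q : state A) <-> exists c, 0 < Z' c /\ H' c = val q.
  rewrite /= -(list_spec_nth 1 hE hZ).
  have := list_spec_mem 0 (val q) hE hZ'; rewrite drop0 => ->.
  by split=> -[c cP]; exists c; move: cP; rewrite addn0.
split=> [acc|[pS [rS wS]] m].
  split; [|split].
  - move=> m i j; have [/(_ i j) pm _ _] := acc m.
    rewrite repP; split; first by case: (pic _ _) => [[]|].
    have [/orP ij|ij] := boolP ((i == 0) || (j == 0)); [left|right].
      split; first by move: pm; case: (pic _ _) ij => //= b [] ->; rewrite ?orbT.
      by case: ij => /eqP ->; [left|right].
    move: pm; rewrite (negPf ij); case: (pic _ _) => [b|//] _.
    split=> [|[] e]; first by case: b.
      by rewrite e in ij.
    by rewrite e orbT in ij.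
  - move=> m i j; have [_ /(_ i j) rm _] := acc m.
    rewrite repR H0E codeE; split; first exact: ltn_ord.
    move: rm => /=; rewrite (list_spec_mem 2 _ hE hZ) => -[c].
    by rewrite addn2; exists c.
  - move=> m i; have [_ _ /(_ i) [x [j [e le f]]]] := acc m.
    exists x, j; rewrite repW; split=> //; split; first by rewrite ltnS.
    by rewrite repR; apply/finE.
split.
- move=> i j; have [_] := pS m i j; rewrite repP.
  case: (pic _ _) => [b|] /= [[e]|[lt]] //; first by case: b e.
    by move=> ij; apply/esym/negbTE/negP => /orP[]/eqP h; apply: ij; tauto.
  by case=> ->; rewrite ?orbT.
- move=> i j; have [_] := rS m i j; rewrite codeE => -[c cP] /=.
  by apply/(list_spec_mem 2 _ hE hZ); exists c; rewrite addn2.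
- move=> i; have [x [j [e [le /[!repR] /finE f]]]] := wS m i.
  by exists x, j; rewrite -repW; split.
Qed.

End AcceptedPoints.

(** * Second-order formulas for uncountable and for infinite languages *)

Definition dense_spec (P R W : nat -> nat) := forall m l : nat, exists m',
  (forall i : nat, i < l -> W (pr m i) = W (pr m' i) /\ forall j : nat, j < l ->
     P (pr m (pr i j)) = P (pr m' (pr i j)) /\
     R (pr m (pr i j)) = R (pr m' (pr i j))) /\
  exists i j, ~ P (pr m (pr i j)) = P (pr m' (pr i j)).

Definition distinct_spec (P : nat -> nat) := forall m m' : nat,
  ~ m = m' -> exists i j, ~ P (pr m (pr i j)) = P (pr m' (pr i j)).

Definition index_family_spec (z : nat) (E Z H Z' H' P R W : nat -> nat) :=
  exp2_spec E /\ list_spec E z Z H /\ list_spec E (H 1) Z' H' /\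
  family_spec E Z H Z' H' P R W.

Section Formulas.
Local Notation tm := (term 8).
Local Notation fm := (formula 8).
Local Notation v := (@t_var 8).
Local Notation fn i t := (@t_app 8 (inord i) t).
Local Notation S := (@t_succ 8).
Local Notation "0" := (t_zero 8).
Local Notation one := (S 0).
Local Notation E := (fun t => fn 0 t).
Local Notation Z := (fun t => fn 1 t).
Local Notation H := (fun t => fn 2 t).
Local Notation Z' := (fun t => fn 3 t).
Local Notation H' := (fun t => fn 4 t).
Local Notation P := (fun t => fn 5 t).
Local Notation R := (fun t => fn 6 t).
Local Notation W := (fun t => fn 7 t).

Definition t_pr (t u : tm) := t_add (t_mul (t_add t u) (t_add t u)) t.
Definition t_pr3 (t u w : tm) := t_pr t (t_pr u w).
Definition t_acons (t u : tm) := t_mul (E t) (S (t_add u u)).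

Definition f_exp2 : fm :=
  f_and (f_eq (E 0) one)
        (f_all (f_eq (E (S (v 0))) (t_add (E (v 0)) (E (v 0))))).

Definition f_list (iz ih : nat) (c : tm) : fm :=
  f_and (f_eq (fn iz 0) c)
   (f_all (f_or (f_and (f_eq (fn iz (v 0)) 0)
                (f_and (f_eq (fn iz (S (v 0))) 0) (f_eq (fn ih (v 0)) 0)))
      (f_eq (fn iz (v 0)) (t_acons (fn ih (v 0)) (fn iz (S (v 0))))))).

Definition t_acode (m i j : tm) : tm :=
  t_acons (P (t_pr3 m i (S j))) (t_acons (R (t_pr3 m i (S j)))
  (t_acons (P (t_pr3 m (S i) (S j))) (t_acons (R (t_pr3 m (S i) (S j)))
  (t_acons (P (t_pr3 m i j)) (t_acons (R (t_pr3 m i j))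
  (t_acons (P (t_pr3 m (S i) j)) (t_acons (R (t_pr3 m (S i) j)) 0))))))).

Definition f_picture : fm :=
  let p := P (t_pr3 (v 2) (v 1) (v 0)) in
  let border := f_or (f_eq (v 1) 0) (f_eq (v 0) 0) in
  f_all (f_all (f_all (f_and (f_lt p (S (S one)))
    (f_or (f_and (f_eq p 0) border) (f_and (f_lt 0 p) (f_not border)))))).

Definition f_run : fm :=
  f_all (f_all (f_all (f_and (f_lt (R (t_pr3 (v 2) (v 1) (v 0))) (H 0))
    (f_ex (f_and (f_lt 0 (Z (S (S (v 0)))))
                 (f_eq (H (S (S (v 0)))) (t_acode (v 3) (v 2) (v 1)))))))).

Definition f_wit : fm :=
  f_all (f_all (f_ex (f_ex (f_and
    (f_eq (W (t_pr (v 3) (v 2))) (t_pr (v 1) (v 0)))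
    (f_and (f_lt (v 2) (S (W (t_pr (v 3) (v 2)))))
      (f_ex (f_and (f_lt 0 (Z' (v 0)))
                   (f_eq (H' (v 0)) (R (t_pr3 (v 4) (v 2) (v 1))))))))))).

Definition f_family : fm :=
  f_and f_exp2 (f_and (f_list 1 2 (v 0)) (f_and (f_list 3 4 (H one))
    (f_and f_picture (f_and f_run f_wit)))).

Definition f_dense : fm :=
  f_all (f_all (f_ex (f_and
    (f_all (f_imp (f_lt (v 0) (v 2)) (f_and
       (f_eq (W (t_pr (v 3) (v 0))) (W (t_pr (v 1) (v 0))))
       (f_all (f_imp (f_lt (v 0) (v 3)) (f_and
          (f_eq (P (t_pr3 (v 4) (v 1) (v 0))) (P (t_pr3 (v 2) (v 1) (v 0))))
          (f_eq (R (t_pr3 (v 4) (v 1) (v 0))) (R (t_pr3 (v 2) (v 1) (v 0))))))))))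
    (f_ex (f_ex (f_not
      (f_eq (P (t_pr3 (v 4) (v 1) (v 0))) (P (t_pr3 (v 2) (v 1) (v 0)))))))))).

Definition f_distinct : fm :=
  f_all (f_all (f_imp (f_not (f_eq (v 1) (v 0)))
    (f_ex (f_ex (f_not
      (f_eq (P (t_pr3 (v 3) (v 1) (v 0))) (P (t_pr3 (v 2) (v 1) (v 0))))))))).

Variable F : 'I_8 -> nat -> nat.
Local Notation G i := (F (inord i)).

Lemma holds_family z : holds F [:: z] f_family <->
  index_family_spec z (G 0) (G 1) (G 2) (G 3) (G 4) (G 5) (G 6) (G 7).
Proof. by holds_iff. Qed.

Lemma holds_dense e : holds F e f_dense <-> dense_spec (G 5) (G 6) (G 7).
Proof. by holds_iff. Qed.

Lemma holds_distinct e : holds F e f_distinct <-> distinct_spec (G 5).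
Proof. by holds_iff. Qed.

End Formulas.

Section Membership.
Variable z : nat.
Local Notation L := (buchi_language (tiling_of_index z)).
Local Notation n := (nth 0 (CodeSeq.decode z) 0).

Lemma represents_agree (D : nat -> run_point z) P R W : represents D P R W ->
  (forall m l, exists m', agree l (D m) (D m') /\ pic (D m') <> pic (D m)) ->
  dense_spec P R W.
Proof.
move=> rep dD m l.
(* [agree] measures closeness by [pickle] codes, [dense_spec] by squares: [b] bounds the codes of
   the cells of the square of side [l]. *)
have [b bP] := pickle_bound [seq (i, j) | i <- iota 0 l, j <- iota 0 l].
have {}bP i j : i < l -> j < l -> pickle (i, j) < b.
  move=> il jl; apply: bP; apply/allpairsP; exists (i, j).
  by rewrite !mem_iota /= add0n.
have [m' [ag dm']] := dD m b; exists m'.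
have [repm repWm] := rep m; have [repm' repWm'] := rep m'.
split=> [i il|].
  split.
    by rewrite repWm repWm' /wit ag // bP // (leq_trans _ il).
  move=> j jl; have [-> ->] := repm i j; have [-> ->] := repm' i j.
  by rewrite /pic /run ag // bP.
apply: contrapT => nex; apply: dm'; apply/funext => -[i j].
apply: contrapT => ne; apply: nex; exists i, j.
have [-> _] := repm i j; have [-> _] := repm' i j.
by move=> /symbol_code_inj e; apply: ne.
Qed.

Lemma represents_inj (D : nat -> run_point z) P R W : represents D P R W ->
  distinct_spec P <-> injective (fun m => pic (D m)).
Proof.
move=> rep; split=> [dP m m' e|inj m m' ne].
  apply: contrapT => /dP[i [j]]; apply.
  have [/(_ i j)[-> _] _] := rep m; have [/(_ i j)[-> _] _] := rep m'.
  by rewrite e.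
apply: contrapT => nex; apply: ne; apply: inj; apply/funext => -[i j].
apply: symbol_code_inj; apply: contrapT => ne; apply: nex; exists i, j.
by have [/(_ i j)[-> _] _] := rep m; have [/(_ i j)[-> _] _] := rep m'.
Qed.

Lemma index_familyP (D : nat -> run_point z) P R W : represents D P R W ->
  (forall m, accepted (D m)) ->
  exists E Z H Z' H', index_family_spec z E Z H Z' H' P R W.
Proof.
move=> rep acc; have [E hE] := exp2_ex; have [Z [H hZ]] := list_spec_ex z hE.
have [Z' [H' hZ']] := list_spec_ex (H 1) hE.
by exists E, Z, H, Z', H'; do 3 split=> //; exact/(family_specP hE hZ hZ' rep).
Qed.

(** The last clause is needed for density: [agree] compares the third components of all cells, while
    [W] controls only one value for each [i]. *)
Lemma index_family_points E Z H Z' H' P R W :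
  index_family_spec z E Z H Z' H' P R W ->
  exists D : nat -> run_point z, [/\ forall m, accepted (D m), represents D P R W &
    forall m i j j', (D m (i, j)).2 = (D m (i, j')).2].
Proof.
move=> [hE [hZ [hZ' fam]]]; have [pS [rS _]] := fam.
have ltR m i j : R (pr m (pr i j)) < n.
  by rewrite -(H0E hE hZ); case: (rS m i j).
pose sym c := nth None [:: None; Some false; Some true] c.
pose D m (u : nat * nat) : option bool * 'I_n * nat :=
  (sym (P (pr m (pr u.1 u.2))), Ordinal (ltR m u.1 u.2), W (pr m u.1)).
have rep : represents (D : nat -> run_point z) P R W.
  move=> m; split=> // i j; split=> //; rewrite /pic /=.
  by have [+ _] := pS m i j; case: (P _) => [|[|[]]].
by exists D; split=> //; apply/(family_specP hE hZ hZ' rep).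
Qed.

Lemma pic_continuous u : exists l, forall y y' : run_point z,
  agree l y y' -> pic y u = pic y' u.
Proof. by exists (pickle u).+1 => y y' yy'; rewrite /pic yy'. Qed.

Lemma uncountable_languageP :
  ~ countable L <-> exists E Z H Z' H' P R W,
    index_family_spec z E Z H Z' H' P R W /\ dense_spec P R W.
Proof.
rewrite -accepted_language; split.
  move=> /dense_family[D [acc dD]]; have [P [R [W rep]]] := represents_ex D.
  have [E [Z [H [Z' [H' fam]]]]] := index_familyP rep acc.
  exists E, Z, H, Z', H', P, R, W; split=> //.
  exact: represents_agree rep dD.
move=> [E [Z [H [Z' [H' [P [R [W [fam dns]]]]]]]]].
have [D [acc rep D2]] := index_family_points fam.
apply: (dense_family_uncountable (@accepted_closed z) pic_continuous acc).
move=> m l.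
(* Conversely, a square of side [b] contains all cells whose code is below [l]. *)
pose box c := let u := odflt (0, 0) (@unpickle (nat * nat)%type c) in
  maxn u.1 u.2.
pose b := (\max_(c <- iota 0 l) box c).+1.
have bP u : pickle u < l -> u.1 < b /\ u.2 < b.
  move=> ul; suff : box (pickle u) < b.
    by rewrite /box pickleK /= gtn_max => /andP[].
  by rewrite ltnS; apply: leq_bigmax_seq => //; rewrite mem_iota.
have [m' [ag [i [j ne]]]] := dns m b; exists m'.
have [repm repWm] := rep m; have [repm' repWm'] := rep m'.
split=> [[i' j'] /bP /= [ib jb]|]; last first.
  move=> e; apply: ne; have [-> _] := repm i j; have [-> _] := repm' i j.
  by rewrite e.
have [eW /(_ j' jb)] := ag i' ib.
have [-> ->] := repm i' j'; have [-> ->] := repm' i' j'.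
move: eW; rewrite repWm repWm' /wit !(D2 _ i' 0 j') /pic /run.
by case: (D m _) (D m' _) => [[? ?] ?] [[? ?] ?] /= -> [] /symbol_code_inj -> /val_inj ->.
Qed.

Lemma infinite_languageP :
  infinite_set L <-> exists E Z H Z' H' P R W,
    index_family_spec z E Z H Z' H' P R W /\ distinct_spec P.
Proof.
rewrite -accepted_language infiniteP; split.
  move=> /pcard_leP[f].
  have /choice[D hD] (m : nat) : exists y : run_point z, accepted y /\ pic y = f m.
    have [y acc e] : (@pic z @` @accepted z) (f m) by exact: funS.
    by exists y.
  have [P [R [W rep]]] := represents_ex D.
  have acc m : accepted (D m) by case: (hD m).
  have [E [Z [H [Z' [H' fam]]]]] := index_familyP rep acc.
  exists E, Z, H, Z', H', P, R, W; split=> //.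
  apply/(represents_inj rep) => m m'.
  have [_ ->] := hD m; have [_ ->] := hD m'.
  by move=> /(inj _); apply; rewrite inE.
move=> [E [Z [H [Z' [H' [P [R [W [fam /represents_inj dst]]]]]]]]].
have [D [acc /dst inj _]] := index_family_points fam.
rewrite -(card_le_eql (@inj_card_eq _ _ [set: nat] (fun m => pic (D m)) _)).
  by apply: subset_card_le => _ [m _ <-]; exists (D m).
by move=> m m' _ _; exact: inj.
Qed.
End Membership.

Lemma ex_functions8 (K : (nat -> nat) -> (nat -> nat) -> (nat -> nat) ->
    (nat -> nat) -> (nat -> nat) -> (nat -> nat) -> (nat -> nat) ->
    (nat -> nat) -> Prop) :
  (exists E Z H Z' H' P R W, K E Z H Z' H' P R W) <->
  exists F : 'I_8 -> nat -> nat, K (F (inord 0)) (F (inord 1)) (F (inord 2))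
    (F (inord 3)) (F (inord 4)) (F (inord 5)) (F (inord 6)) (F (inord 7)).
Proof.
split=> [[E [Z [H [Z' [H' [P [R [W hK]]]]]]]]|[F hK]]; last first.
  by do 8 eexists; exact: hK.
exists (fun i => nth id [:: E; Z; H; Z'; H'; P; R; W] i).
by rewrite !inordK.
Qed.

Lemma Sigma11_uncountable :
  Sigma11 [set z | ~ countable (buchi_language (tiling_of_index z))].
Proof.
exists 8, (f_and f_family f_dense) => z.
apply: (iff_trans (uncountable_languageP z)); rewrite ex_functions8.
split=> -[F [fam spec]]; exists F; split; first exact/holds_family.
- exact/holds_dense.
- exact/holds_family.
- exact/(holds_dense F [:: z]).
Qed.

Lemma Sigma11_infinite :
  Sigma11 [set z | infinite_set (buchi_language (tiling_of_index z))].
Proof.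
exists 8, (f_and f_family f_distinct) => z.
apply: (iff_trans (infinite_languageP z)); rewrite ex_functions8.
split=> -[F [fam spec]]; exists F; split; first exact/holds_family.
- exact/holds_distinct.
- exact/holds_family.
- exact/(holds_distinct F [:: z]).
Qed.

(** * A normal form for Sigma11 sets *)

Section NormalForm.
Variable S : Type.

(* [nX] is the universally quantified number variable; [nN] is a parameter, to
   be instantiated by [n.+2] when testing the membership of [n]. *)
Inductive nterm := nX | nN | nO | nS (t : nterm) | nF (s : S) (t : nterm).
Inductive npos :=
| n_eq (t u : nterm) | n_and (p q : npos) | n_or (p q : npos).

Variable (f : S -> nat -> nat) (N x : nat).

Fixpoint nval (t : nterm) : nat :=
  match t with
  | nX => x | nN => N | nO => 0 | nS t => (nval t).+1 | nF s t => f s (nval t)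
  end.

Fixpoint nsat (p : npos) : Prop :=
  match p with
  | n_eq t u => nval t = nval u
  | n_and p q => nsat p /\ nsat q
  | n_or p q => nsat p \/ nsat q
  end.
End NormalForm.

Arguments nX {S}.
Arguments nN {S}.
Arguments nO {S}.

(* The Cantor walk (0, b) -> (b + 1, 0), (a + 1, b) -> (a, b + 1) meets every
   pair, and its steps are expressible by successors alone. *)
Definition cantor_step (u : nat * nat) : nat * nat :=
  if u.1 is a.+1 then (a, u.2.+1) else (u.2.+1, 0).

Definition walk x := iter x cantor_step (0, 0).

Lemma walk_surj a b : exists x, walk x = (a, b).
Proof.
have diag s d : d <= s -> (exists x, walk x = (s, 0)) ->
    exists x, walk x = (s - d, d).
  move=> ds [x xE]; exists (d + x); elim: d ds => [|d IH] ds.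
    by rewrite add0n subn0.
  by rewrite addSn /walk iterS -/(walk _) IH ?(ltnW ds) // /cantor_step /=
    -(subnSK ds).
have row s : exists x, walk x = (s, 0).
  elim: s => [|s IH]; first by exists 0.
  have [x xE] := diag s s (leqnn s) IH.
  by exists x.+1; rewrite /walk iterS -/(walk x) xE subnn.
by have := diag (a + b) b (leq_addl _ _) (row _); rewrite addnK.
Qed.

(** Tails of environment codes decrease strictly until they reach 0, so that the entries of the
    environment coded by [x] vanish beyond position [x]. *)
Lemma walk2_le x : (walk x).2 <= x.-1.
Proof.
elim: x => // x; rewrite /walk iterS -/(walk x) /cantor_step.
by case E: (walk x) => [[|a] b] //= le; case: x E le.
Qed.

Lemma holds_ext k (F : 'I_k -> nat -> nat) (phi : formula k) e e' :
  nth 0 e =1 nth 0 e' -> holds F e phi <-> holds F e' phi.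
Proof.
have term_ext d d' : nth 0 d =1 nth 0 d' -> term_eval F d =1 term_eval F d'.
  move=> dd'; elim=> //= [t ->|t -> u ->|t -> u ->|i t ->] //.
elim: phi e e' => [t u|t u|p IHp|p IHp q IHq|p IHp] e e' ee' /=.
- by rewrite !(term_ext _ _ ee').
- by rewrite !(term_ext _ _ ee').
- by rewrite (IHp _ _ ee').
- by rewrite (IHp _ _ ee') (IHq _ _ ee').
- have ee m : nth 0 (m :: e) =1 nth 0 (m :: e') by case.
  by split=> -[m /(IHp _ _ (ee m)) pm]; exists m.
Qed.

Section Clauses.
Variable k : nat.

(* Numbers code environments, [Hd] and [Tl] being the components of the
   Cantor walk; [T t] and [P phi] tabulate the values of terms and the truth
   values of formulas in all environments, [Dec], [Mix], [Tw], [Pw] and [Root]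
   give Skolem witnesses. *)
Inductive sym := Hd | Tl | Add | Mul | Dec | Mix | Root | Orc (i : 'I_k)
| T (t : term k) | Tw (t : term k) | P (p : formula k) | Pw (p : formula k).

Local Notation hd := (nF Hd).
Local Notation tl := (nF Tl).
Local Notation add := (nF Add).
Local Notation mul := (nF Mul).
Local Notation dec := (nF Dec nX).
Local Notation mix := (nF Mix nX).
Local Notation root := (nF Root nO).
Local Notation one := (nS nO).
Local Notation "t == u" := (n_eq t u).
Local Notation "p /\ q" := (n_and p q).
Local Notation "p \/ q" := (n_or p q).

(** The first clauses force [Hd] and [Tl] to follow the Cantor walk. The others are the recursions
    of sum and product on the first component: [Dec] codes the pair with that component decremented,
    [Mix] the pair whose sum is the product. *)
Definition base_clause : npos sym :=
  (hd nO == nO) /\ (tl nO == nO) /\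
  (((hd nX == nO) /\ (hd (nS nX) == nS (tl nX)) /\ (tl (nS nX) == nO)) \/
   ((hd nX == nS (hd (nS nX))) /\ (tl (nS nX) == nS (tl nX)))) /\
  (((hd nX == nO) /\ (add nX == tl nX)) \/
   ((hd nX == nS (hd dec)) /\ (tl dec == tl nX) /\
    (add nX == nS (add dec)))) /\
  (((hd nX == nO) /\ (mul nX == nO)) \/
   ((hd nX == nS (hd dec)) /\ (tl dec == tl nX) /\ (hd mix == mul dec) /\
    (tl mix == tl nX) /\ (mul nX == add mix))).

Fixpoint term_clause (t : term k) : npos sym :=
  let v t := nF (T t) nX in let w := nF (Tw t) nX in
  match t with
  | t_var i => v t == hd (iter i (fun t => tl t) nX)
  | t_zero => v t == nO
  | t_succ u => (v t == nS (v u)) /\ term_clause u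
  | t_add u1 u2 => ((hd w == v u1) /\ (tl w == v u2) /\ (v t == add w)) /\
                   term_clause u1 /\ term_clause u2
  | t_mul u1 u2 => ((hd w == v u1) /\ (tl w == v u2) /\ (v t == mul w)) /\
                   term_clause u1 /\ term_clause u2
  | t_app i u => (v t == nF (Orc i) (v u)) /\ term_clause u
  end.

Fixpoint form_clause (p : formula k) : npos sym :=
  let c p := nF (P p) nX in let w := nF (Pw p) nX in let v t := nF (T t) nX in
  let lt t u := (hd w == v t) /\ (nS (add w) == v u) in
  match p with
  | f_eq t u => (((c p == one) /\ (v t == v u)) \/
                 ((c p == nO) /\ (lt t u \/ lt u t))) /\
                term_clause t /\ term_clause u
  | f_lt t u => (((c p == one) /\ lt t u) \/
                 ((c p == nO) /\ (hd w == v u) /\ (add w == v t))) /\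
                term_clause t /\ term_clause u
  | f_not q => (((c p == one) /\ (c q == nO)) \/
                ((c p == nO) /\ (c q == one))) /\ form_clause q
  | f_and q r => (((c p == one) /\ (c q == one) /\ (c r == one)) \/
                  ((c p == nO) /\ ((c q == nO) \/ (c r == nO)))) /\
                 form_clause q /\ form_clause r
  | f_ex q => ((c q == nO) \/ (nF (P p) (tl nX) == one)) /\
              (((c p == one) /\ (tl w == nX) /\ (nF (P q) w == one)) \/
               (c p == nO)) /\ form_clause q
  end.

(** [root] codes the environment [[:: n]] when [nN] is [n.+2]: 0 codes the environment that is 0
    everywhere. *)
Definition clauses (p : formula k) : npos sym :=
  base_clause /\ form_clause p /\
  (nS (nS (hd root)) == nN) /\ (tl root == nO) /\ (nF (P p) root == one).
End Clauses.
Arguments Hd {k}.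
Arguments Tl {k}.
Arguments Add {k}.
Arguments Mul {k}.
Arguments Dec {k}.
Arguments Mix {k}.
Arguments Root {k}.

(** * Solutions of the clauses make the formula true *)

Section Soundness.
Variables (k : nat) (f : sym k -> nat -> nat) (N : nat).
Hypothesis base : forall x, nsat f N x (@base_clause k).
Local Notation F := (fun i => f (Orc i)).

Lemma model_walk x : walk x = (f Hd x, f Tl x).
Proof.
elim: x => [|x IH]; first by have [/= -> [/= -> _]] := base 0.
rewrite /walk iterS -/(walk x) IH /cantor_step /=.
have [_ [_ [+ _]]] := base x.
by move=> /= [[-> [-> ->]]|[-> ->]].
Qed.

Lemma model_pair a b : exists x, f Hd x = a /\ f Tl x = b.
Proof. by have [x] := walk_surj a b; rewrite model_walk => -[<- <-]; exists x. Qed.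

Lemma model_add x : f Add x = f Hd x + f Tl x.
Proof.
have [a] := ubnP (f Hd x); elim: a x => // a IH x ltx.
have [_ [_ [_ [+ _]]]] := base x; move=> /= [[-> ->]|[h [t ->]]] //.
by rewrite IH ?h ?t // -ltnS -h.
Qed.

Lemma model_mul x : f Mul x = f Hd x * f Tl x.
Proof.
have [a] := ubnP (f Hd x); elim: a x => // a IH x ltx.
have [_ [_ [_ [_ +]]]] := base x; move=> /= [[-> ->]|[h [t [hm [tm ->]]]]] //.
rewrite model_add hm tm IH; last by rewrite -ltnS -h.
by rewrite h t mulSn addnC.
Qed.

Definition env_code x e := forall i, nth 0 e i = f Hd (iter i (f Tl) x).

Lemma env_code_cons x e : env_code (f Tl x) e -> env_code x (f Hd x :: e).
Proof. by move=> xe [|i] //=; rewrite xe -iterSr. Qed.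

Lemma model_term t : (forall x, nsat f N x (term_clause t)) ->
  forall x e, env_code x e -> f (T t) x = term_eval F e t.
Proof.
elim: t => [i||t IH|t IHt u IHu|t IHt u IHu|i t IH] /= tP x e xe.
- rewrite tP xe; congr (f Hd _); clear; by elim: i => //= i ->.
- by rewrite tP.
- by have [-> /=] := tP x; rewrite (IH _ x e) // => y; case: (tP y).
- have [[h [t' ->]] _] := tP x; rewrite model_add h t'.
  by rewrite (IHt _ x e) ?(IHu _ x e) // => y; case: (tP y) => _ [].
- have [[h [t' ->]] _] := tP x; rewrite model_mul h t'.
  by rewrite (IHt _ x e) ?(IHu _ x e) // => y; case: (tP y) => _ [].
- by have [-> _] := tP x; rewrite (IH _ x e) // => y; case: (tP y).
Qed.

Lemma model_form p : (forall x, nsat f N x (form_clause p)) ->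
  forall x e, env_code x e -> f (P p) x = `[< holds F e p >].
Proof.
elim: p => [t u|t u|p IH|p IHp q IHq|p IH] /= pP x e xe.
- have tE := @model_term t (fun y => (pP y).2.1) x e xe.
  have uE := @model_term u (fun y => (pP y).2.2) x e xe.
  have [+ _] := pP x; rewrite tE uE model_add.
  case: asboolP => /= ? ?; lia.
- have tE := @model_term t (fun y => (pP y).2.1) x e xe.
  have uE := @model_term u (fun y => (pP y).2.2) x e xe.
  have [+ _] := pP x; rewrite tE uE model_add.
  case: asboolP => /= ? ?; lia.
- have pE := IH (fun y => (pP y).2) x e xe.
  by have [+ _] := pP x; rewrite pE asbool_neg; case: asboolP => ? [[-> ]|[-> ]].
- have pE := IHp (fun y => (pP y).2.1) x e xe.
  have qE := IHq (fun y => (pP y).2.2) x e xe.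
  have [+ _] := pP x; rewrite pE qE asbool_and.
  by do 2!case: asboolP => ? //=; case=> -[-> []].
- have pE := IH (fun y => (pP y).2.2).
  case: asboolP => [[m hm]|nh]; last first.
    have [_ [[[e1 [tw pw]]|-> //] _]] := pP x.
    case: nh; exists (f Hd (f (Pw (f_ex p)) x)); move: pw.
    by rewrite (pE _ (f Hd (f (Pw (f_ex p)) x) :: e)); first case: asboolP => //;
       apply: env_code_cons; rewrite tw.
  (* The clause is applied at the code [y] of [m :: e], whose tail is [x]. *)
  have [y [yh yt]] := model_pair m x.
  have [[py|py] _] := pP y; last by rewrite -yt py.
  move: py; rewrite (pE _ (m :: e)); first by case: asboolP.
  by rewrite -yh; apply: env_code_cons; rewrite yt.
Qed.

End Soundness.

Lemma clauses_sound k (p : formula k) (f : sym k -> nat -> nat) n :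
  (forall x, nsat f n.+2 x (clauses p)) ->
  holds (fun i => f (Orc i)) [:: n] p.
Proof.
move=> fP; have base x : nsat f n.+2 x (@base_clause k) by case: (fP x).
have [_ [_ [/= [h] [/= t /= r]]]] := fP 0.
have [/= h0 [/= t0 _]] := base 0.
have codeR : env_code f (f Root 0) [:: n].
  case=> [|i]; first by rewrite h.
  by rewrite iterSr t [LHS]nth_nil; elim: i => // i; rewrite iterSr t0.
have := model_form base (fun x => (fP x).2.1) codeR.
by rewrite r; case: asboolP.
Qed.

(** * The intended solution of the clauses *)

Section Completeness.
Variables (k : nat) (F : 'I_k -> nat -> nat) (n : nat).

Definition unwalk a b : nat := sval (cid (walk_surj a b)).

Lemma unwalkK a b : walk (unwalk a b) = (a, b).
Proof. exact: svalP (cid (walk_surj a b)). Qed.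

Definition tail_walk i x := iter i (fun y => (walk y).2) x.

Definition env x := mkseq (fun i => (walk (tail_walk i x)).1) x.+1.

Lemma nth_env x i : nth 0 (env x) i = (walk (tail_walk i x)).1.
Proof.
have [ltx|lex] := ltnP i x.+1; first by rewrite nth_mkseq.
rewrite nth_default ?size_mkseq //.
have le j : tail_walk j x <= x - j.
  elim: j => [|j IH]; first by rewrite subn0.
  apply: leq_trans (walk2_le _) _; rewrite subnS -!subn1; exact: leq_sub2r.
have := le i; have /eqP -> : x - i == 0 by rewrite subn_eq0 ltnW.
by rewrite leqn0 => /eqP ->.
Qed.

Lemma env_unwalk m x : nth 0 (env (unwalk m x)) =1 nth 0 (m :: env x).
Proof.
case=> [|i]; rewrite nth_env [RHS]/=; first by rewrite /= unwalkK.
by rewrite nth_env /tail_walk iterSr unwalkK.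
Qed.

Definition ex_witness (p : formula k) x : nat :=
  if pselect (exists m, holds F (m :: env x) p) is left h then sval (cid h)
  else 0.

(** The tables hold the actual values, and the remaining symbols are Skolem functions; [gap] pairs
    the smaller number with the difference minus 1, as [form_clause] expects. *)
Definition model (s : sym k) x : nat :=
  let hd := (walk x).1 in let tl := (walk x).2 in
  let ev t := term_eval F (env x) t in
  let gap a b := if a < b then unwalk a (b - a.+1) else unwalk b (a - b.+1) in
  match s with
  | Hd => hd
  | Tl => tl
  | Add => hd + tl
  | Mul => hd * tl
  | Dec => unwalk hd.-1 tl
  | Mix => unwalk (hd.-1 * tl) tl
  | Root => unwalk n 0
  | Orc i => F i x
  | T t => ev t
  | Tw (t_add t u) => unwalk (ev t) (ev u)
  | Tw (t_mul t u) => unwalk (ev t) (ev u)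
  | Tw _ => 0
  | P p => `[< holds F (env x) p >]
  | Pw (f_eq t u) => gap (ev t) (ev u)
  | Pw (f_lt t u) => if ev t < ev u then unwalk (ev t) (ev u - (ev t).+1)
                     else unwalk (ev u) (ev t - ev u)
  | Pw (f_ex p) => unwalk (ex_witness p x) x
  | Pw _ => 0
  end.

Variable x : nat.
Local Notation sat := (nsat model n.+2 x).

Lemma model_base : sat (base_clause k).
Proof.
have wS : walk x.+1 = cantor_step (walk x) by [].
rewrite /base_clause /nsat /nval /model wS !unwalkK /cantor_step.
case: (walk x) => [[|a] b] /=; do 2![split=> //].
  by split; [left|split; left].
split; [by right|split; right=> //].
by rewrite mulSn addnC.
Qed.

Lemma model_term_clause t : sat (term_clause t).
Proof.
elim: t => [i||t IH|t IHt u IHu|t IHt u IHu|i t IH] //=; rewrite ?unwalkK //.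
by rewrite nth_env; congr (walk _).1; elim: i => //= i ->.
Qed.

Lemma model_form_clause p : sat (form_clause p).
Proof.
elim: p => [t u|t u|p IH|p IHp q IHq|p IH] /=.
- split; last by split; exact: model_term_clause.
  by case: asboolP => e; [left|right]; split=> //; case: ltngtP e => // lt _;
     [left|right]; rewrite unwalkK /=; split=> //; rewrite -addSn subnKC.
- split; last by split; exact: model_term_clause.
  case: asboolP => [lt|/negP nlt]; [left|right]; split=> //.
    by rewrite lt unwalkK /= -addSn subnKC.
  by rewrite (negPf nlt) unwalkK /= subnKC // leqNgt.
- by split=> //; rewrite asbool_neg; case: asboolP; [right|left].
- split=> //; rewrite asbool_and; do 2!case: asboolP => ? /=; [by left| | |];
    by right; split=> //; tauto.
- split; last split=> //.
    case: asboolP => h; [right|by left]; case: asboolP => // nex; case: nex.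
    have ext : nth 0 (env x) =1 nth 0 ((walk x).1 :: env (walk x).2).
      by case=> [|i]; rewrite nth_env // [RHS]/= nth_env /tail_walk iterSr.
    by exists (walk x).1; apply/(holds_ext F p ext).
  rewrite unwalkK /=; case: (asboolP (exists m, _)) => ex; [left|by right].
  split=> //; split=> //; case: asboolP => // nh; case: nh.
  apply/(holds_ext F p (env_unwalk _ _)); rewrite /ex_witness.
  by case: pselect => // h; exact: svalP (cid h).
Qed.

Lemma model_clauses p : holds F [:: n] p -> sat (clauses p).
Proof.
move=> hp; split; first exact: model_base.
split; first exact: model_form_clause.
rewrite /= unwalkK; do 2!split=> //; case: asboolP => // nh; case: nh.
have ext : nth 0 [:: n] =1 nth 0 (n :: env 0).
  case=> // i; rewrite [LHS]nth_nil [RHS]/= nth_env.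
  by have -> : tail_walk i 0 = 0 by elim: i => //= i ->.
by apply/(holds_ext F p (env_unwalk n 0)); apply/(holds_ext F p ext).
Qed.

End Completeness.

Theorem Sigma11_normal_form (A : set nat) : Sigma11 A ->
  exists (S : Type) (p : npos S), forall n,
    A n <-> exists f : S -> nat -> nat, forall x, nsat f n.+2 x p.
Proof.
move=> [k [phi hA]]; exists (sym k), (clauses phi) => n; split.
  by move=> /hA[F hF]; exists (model F n) => x; exact: model_clauses.
move=> [f fP]; apply/hA; exists (fun i => f (Orc i)).
exact: clauses_sound fP.
Qed.

(** * Programs on registers and oracle tapes *)

Section Finitize.
Variable S : Type.

Fixpoint nterm_map (S' : Type) (g : S -> S') (t : nterm S) : nterm S' :=
  match t with
  | nX => nX | nN => nN | nO => nO
  | nS t => nS (nterm_map g t)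
  | nF s t => nF (g s) (nterm_map g t)
  end.

Fixpoint npos_map (S' : Type) (g : S -> S') (p : npos S) : npos S' :=
  match p with
  | n_eq t u => n_eq (nterm_map g t) (nterm_map g u)
  | n_and p q => n_and (npos_map g p) (npos_map g q)
  | n_or p q => n_or (npos_map g p) (npos_map g q)
  end.

Fixpoint nterm_syms (t : nterm S) : seq {classic S} :=
  match t with
  | nX | nN | nO => [::]
  | nS t => nterm_syms t
  | nF s t => (s : {classic S}) :: nterm_syms t
  end.

Fixpoint npos_syms (p : npos S) : seq {classic S} :=
  match p with
  | n_eq t u => nterm_syms t ++ nterm_syms u
  | n_and p q | n_or p q => npos_syms p ++ npos_syms q
  end.

Lemma nsat_map (S' : Type) (g : S -> S') f f' N x p :
  {in npos_syms p, forall s, f' (g s) = f s} ->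
  nsat f' N x (npos_map g p) <-> nsat f N x p.
Proof.
have val t : {in nterm_syms t, forall s, f' (g s) = f s} ->
    nval f' N x (nterm_map g t) = nval f N x t.
  elim: t => //= [t IH /IH-> //|s t IH gf]; rewrite gf ?mem_head // IH //.
  by move=> s' s't; rewrite gf // inE s't orbT.
have catP (s1 s2 : seq {classic S}) :
    {in s1 ++ s2, forall s, f' (g s) = f s} ->
    {in s1, forall s, f' (g s) = f s} /\ {in s2, forall s, f' (g s) = f s}.
  by move=> h; split=> s hs; rewrite h // mem_cat hs ?orbT.
by elim: p => [t u|p IHp q IHq|p IHp q IHq] /= /catP[h1 h2];
  rewrite ?val ?IHp ?IHq.
Qed.

(** Only the symbols occurring in [p] matter; they are numbered by their position in [npos_syms p],
    [{classic S}] providing the equality test. *)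
Lemma npos_finitize (p : npos S) : exists (k : nat) (p' : npos 'I_k.+1),
  forall N, (exists f, forall x, nsat f N x p) <->
            (exists f, forall x, nsat f N x p').
Proof.
pose syms := npos_syms p; pose k := size syms.
pose g (s : S) : 'I_k.+1 := inord (index (s : {classic S}) syms).
exists k, (npos_map g p) => N; split=> -[f fP].
  pose f' (i : 'I_k.+1) := if nth None (map Some syms) i is Some s then f s else id.
  have f'E : {in syms, forall s, f' (g s) = f s}.
    move=> s sp; rewrite /f' inordK ?ltnS ?index_size //.
    by rewrite (nth_map s) ?index_mem // nth_index.
  by exists f' => x; apply/(nsat_map N x f'E).
have fE : {in syms, forall s, f (g s) = (f \o g) s} by [].
by exists (f \o g) => x; apply/(nsat_map N x fE).
Qed.
End Finitize.

(** The registers hold the number of the clause being checked ([rX]), the parameter ([rN]), the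
    values of the two sides of an equation ([rA], [rB]) and a position on a tape ([rP]). *)
Definition reg := 'I_5.
Definition rX : reg := @Ordinal 5 0 isT.
Definition rN : reg := @Ordinal 5 1 isT.
Definition rA : reg := @Ordinal 5 2 isT.
Definition rB : reg := @Ordinal 5 3 isT.
Definition rP : reg := @Ordinal 5 4 isT.

Definition store := reg -> nat.
Definition upd (s : store) (r : reg) v : store := fun r' => if r' == r then v else s r'.

Lemma upd_same (s : store) r v : upd s r v r = v. Proof. by rewrite /upd eqxx. Qed.

Lemma upd_other (s : store) r v r' : r' != r -> upd s r v r' = s r'.
Proof. by rewrite /upd => /negPf->. Qed.

Section Programs.
Variable I : Type.
Implicit Types s : store.

Inductive act :=
| Inc (r : reg) | Decr (r : reg) | Zero (r : reg) | Clear (r : reg)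
| Copy (r r' : reg) | Same (r r' : reg) | Read (i : I) (r : reg) (b : bool)
| Skip.

Inductive prog :=
| Atom (a : act) | Seq (p q : prog) | Alt (p q : prog) | Star (p : prog).

(* Programs are run by automata whose states, rather than edges, carry the
   actions: in the tiling, the state of a row then determines the local rule. *)
Fixpoint ctl (p : prog) : finType :=
  match p with
  | Atom _ => unit
  | Seq p q => (ctl p + ctl q)%type
  | Alt p q => (bool + (ctl p + ctl q))%type
  | Star p => option (ctl p)
  end.

Fixpoint entry (p : prog) : ctl p :=
  match p with
  | Atom _ => tt
  | Seq p _ => inl (entry p)
  | Alt _ _ => inl true
  | Star _ => None
  end.

Fixpoint exit (p : prog) : ctl p :=
  match p with
  | Atom _ => tt
  | Seq _ q => inr (exit q)
  | Alt _ _ => inl false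
  | Star _ => None
  end.

Fixpoint lab (p : prog) : ctl p -> act :=
  match p with
  | Atom a => fun _ => a
  | Seq p q => fun c => match c with inl c => lab c | inr c => lab c end
  | Alt p q => fun c => match c with
      | inl _ => Skip | inr (inl c) => lab c | inr (inr c) => lab c end
  | Star p => fun c => if c is Some c then lab c else Skip
  end.

Fixpoint cnext (p : prog) : rel (ctl p) :=
  match p with
  | Atom _ => fun _ _ => false
  | Seq p q => fun c d => match c, d with
      | inl c, inl d => cnext c d
      | inl c, inr d => (c == exit p) && (d == entry q)
      | inr c, inr d => cnext c d
      | _, _ => false
      end
  | Alt p q => fun c d => match c, d with
      | inl true, inr (inl d) => d == entry p
      | inl true, inr (inr d) => d == entry q
      | inr (inl c), inl false => c == exit p
      | inr (inr c), inl false => c == exit q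
      | inr (inl c), inr (inl d) => cnext c d
      | inr (inr c), inr (inr d) => cnext c d
      | _, _ => false
      end
  | Star p => fun c d => match c, d with
      | None, Some d => d == entry p
      | Some c, None => c == exit p
      | Some c, Some d => cnext c d
      | None, None => false
      end
  end.

Variable O : I -> nat -> bool.

Definition guard (a : act) s : bool :=
  match a with
  | Decr r => 0 < s r
  | Zero r => s r == 0
  | Same r r' => s r == s r'
  | Read i r b => O i (s r) == b
  | _ => true
  end.

Definition effect (a : act) s : store :=
  match a with
  | Inc r => upd s r (s r).+1
  | Decr r => upd s r (s r).-1
  | Clear r => upd s r 0
  | Copy r r' => upd s r (s r')
  | _ => s
  end.

Definition step a s s' := guard a s /\ s' = effect a s.

(** Since states carry the actions, a path also performs the action of its last state; [Skip] at
    both ends of [Alt] and at the hub of [Star] keeps this neutral. *)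
Inductive exec (C : Type) (l : C -> act) (nx : rel C) :
    C -> store -> C -> store -> Prop :=
| exec1 c s s' : step (l c) s s' -> exec l nx c s c s'
| execS c s s1 c1 d s' : step (l c) s s1 -> nx c c1 ->
    exec l nx c1 s1 d s' -> exec l nx c s d s'.

Inductive star (R : store -> store -> Prop) : store -> store -> Prop :=
| star0 s : star R s s
| starS s s1 s' : R s s1 -> star R s1 s' -> star R s s'.

Fixpoint sem (p : prog) : store -> store -> Prop :=
  match p with
  | Atom a => step a
  | Seq p q => fun s s' => exists2 s1, sem p s s1 & sem q s1 s'
  | Alt p q => fun s s' => sem p s s' \/ sem q s s'
  | Star p => star (sem p)
  end.

Lemma exec_map (C D : Type) (l : C -> act) (l' : D -> act) (nx : rel C)
    (nx' : rel D) (h : C -> D) :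
  (forall c, l' (h c) = l c) -> (forall c d, nx c d -> nx' (h c) (h d)) ->
  forall c s d s', exec l nx c s d s' -> exec l' nx' (h c) s (h d) s'.
Proof.
move=> hl hn c s d s'; elim=> {c s d s'} [c s s' st|c s s1 c1 d s' st nc _].
  by apply: exec1; rewrite hl.
by apply: execS (hn _ _ nc); rewrite hl.
Qed.

Lemma exec_cat (C : Type) (l : C -> act) (nx : rel C) c s d s1 c' d' s' :
  exec l nx c s d s1 -> nx d c' -> exec l nx c' s1 d' s' ->
  exec l nx c s d' s'.
Proof.
elim=> {c s d s1} [c s s1 st|c s s1 c1 d s2 st nc _ IH] dc ex.
  exact: execS st dc ex.
exact: execS st nc (IH dc ex).
Qed.

Lemma skip_step s : step Skip s s. Proof. by []. Qed.

Definition run_to p (c : ctl p) s s' := exec (@lab p) (@cnext p) c s (exit p) s'.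

(** Induction on the run. All control states [c] have to be treated, since the rest of a run starts
    in the middle of the program. *)
Lemma run_to_Seq p q (c : ctl (Seq p q)) s s' : run_to c s s' ->
  match c with
  | inl c => exists2 s1, run_to c s s1 & run_to (entry q) s1 s'
  | inr c => run_to c s s'
  end.
Proof.
rewrite /run_to; move E: (exit _) => d ex; elim: ex E => {c s d s'} [c s s' st|].
  by move=> E; subst c; apply: exec1.
move=> [c|c] s s1 [c1|c1] d s' st //= nc _ IH E.
- have [s2 r1 r2] := IH E; exists s2 => //.
  exact: (execS (l := @lab p) st nc r1).
- have r := IH E; move: st; case/andP: nc r => /eqP-> /eqP-> r st.
  by exists s1 => //; exact: (exec1 (l := @lab p)).
- exact: (execS (l := @lab q) st nc (IH E)).
Qed.

Lemma run_to_Alt p q (c : ctl (Alt p q)) s s' : run_to c s s' ->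
  match c with
  | inl true => run_to (entry p) s s' \/ run_to (entry q) s s'
  | inl false => s = s'
  | inr (inl c) => run_to c s s'
  | inr (inr c) => run_to c s s'
  end.
Proof.
rewrite /run_to; move E: (exit _) => d ex; elim: ex E => {c s d s'} [c s s' st|].
  by move=> E; subst c; case: st => _ ->.
move=> [[]|[c|c]] s s1 [[]|[c1|c1]] d s' st //= nc ex IH E.
- by left; case: st => _ /= e; subst s1; rewrite -(eqP nc); exact: IH.
- by right; case: st => _ /= e; subst s1; rewrite -(eqP nc); exact: IH.
- by rewrite -(IH E); move: st; rewrite (eqP nc) => st; exact: (exec1 (l := @lab p)).
- exact: (execS (l := @lab p) st nc (IH E)).
- by rewrite -(IH E); move: st; rewrite (eqP nc) => st; exact: (exec1 (l := @lab q)).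
- exact: (execS (l := @lab q) st nc (IH E)).
Qed.

Lemma run_to_Star p (c : ctl (Star p)) s s' : run_to c s s' ->
  match c with
  | None => star (run_to (entry p)) s s'
  | Some c => exists2 s1, run_to c s s1 & star (run_to (entry p)) s1 s'
  end.
Proof.
rewrite /run_to; move E: (exit _) => d ex; elim: ex E => {c s d s'} [c s s' st|].
  by move=> E; subst c; case: st => _ ->; exact: star0.
move=> [c|] s s1 [c1|] d s' st //= nc ex IH E.
- have [s2 r1 r2] := IH E; exists s2 => //.
  exact: (execS (l := @lab p) st nc r1).
- exists s1; last exact: IH.
  by move: st; rewrite (eqP nc) => st; exact: (exec1 (l := @lab p)).
- case: st => _ /= e; subst s1; have [s2 + r2] := IH E; rewrite (eqP nc) => r1.
  exact: starS r1 r2.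
Qed.

Lemma semP p s s' : run_to (entry p) s s' <-> sem p s s'.
Proof.
elim: p s s' => [a|p IHp q IHq|p IHp q IHq|p IH] s s' /=.
- split; last exact: (exec1 (l := @lab (Atom a))).
  have atomP (c d : ctl (Atom a)) t t' :
    exec (@lab (Atom a)) (@cnext (Atom a)) c t d t' -> step a t t' by case.
  exact: atomP.
- split=> [/run_to_Seq[s1 /IHp r1 /IHq r2]|[s1 /IHp r1 /IHq r2]].
    by exists s1.
  apply: exec_cat (exec_map (h := inl) _ _ r1) _ (exec_map (h := inr) _ _ r2) => //.
  by rewrite /= !eqxx.
- split=> [/run_to_Alt[/IHp|/IHq] r|[/IHp|/IHq] r]; [by left|by right| |].
    apply: (execS (l := @lab (Alt p q)) (c := inl true) (c1 := inr (inl (entry p)))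
      (skip_step s)); first exact: eqxx.
    have r' : exec (@lab (Alt p q)) (@cnext (Alt p q))
      (inr (inl (entry p))) s (inr (inl (exit p))) s'.
      exact: (exec_map (h := inr \o inl) _ _ r).
    apply: (exec_cat r' (c' := inl false)); first exact: eqxx.
    exact: (@exec1 _ (@lab (Alt p q)) _ (inl false)).
  apply: (execS (l := @lab (Alt p q)) (c := inl true) (c1 := inr (inr (entry q)))
    (skip_step s)); first exact: eqxx.
  have r' : exec (@lab (Alt p q)) (@cnext (Alt p q))
      (inr (inr (entry q))) s (inr (inr (exit q))) s'.
      exact: (exec_map (h := inr \o inr) _ _ r).
    apply: (exec_cat r' (c' := inl false)); first exact: eqxx.
    exact: (@exec1 _ (@lab (Alt p q)) _ (inl false)).
- split=> [/run_to_Star|].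
    by elim=> {s s'} [s|s s1 s' /IH r _]; [exact: star0 | exact: starS].
  elim=> {s s'} [s|s s1 s' /IH r _ st].
    exact: (@exec1 _ (@lab (Star p)) _ None).
  apply: (execS (l := @lab (Star p)) (c := None) (c1 := Some (entry p)) (skip_step s));
    first exact: eqxx.
  have r' : exec (@lab (Star p)) (@cnext (Star p))
    (Some (entry p)) s (Some (exit p)) s1.
    exact: (exec_map (h := some) _ _ r).
  apply: (exec_cat r' (c' := None)) st; exact: eqxx.
Qed.

End Programs.

(* A function is stored as the bit sequence 1^f(0) 0 1^f(1) 0 ...; the block of
   index [x] starts at position [p]. *)
Section Blocks.
Variable w : nat -> bool.

Definition ones p l := forall k, k < l -> w (p + k).

Inductive block : nat -> nat -> Prop :=
| block0 : block 0 0
| blockS x p l : block x p -> ones p l -> ~~ w (p + l) -> block x.+1 (p + l).+1.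

Definition entry_of x y := exists p, [/\ block x p, ones p y & ~~ w (p + y)].

Lemma ones_inj p l l' : ones p l -> ~~ w (p + l) -> ones p l' -> ~~ w (p + l') ->
  l = l'.
Proof.
move=> o n o' n'; case: (ltngtP l l') => // lt.
  by rewrite o' in n.
by rewrite o in n'.
Qed.

Lemma block_inj x p p' : block x p -> block x p' -> p = p'.
Proof.
move=> b; elim: b p' => [|{}x {}p l _ IH o n] p' b'; inversion b' => //.
by move: H1 H2; rewrite -(IH _ H0) => o' n'; rewrite (ones_inj o n o' n').
Qed.

Lemma entry_of_inj x y y' : entry_of x y -> entry_of x y' -> y = y'.
Proof.
move=> [p [b o n]] [p' [b']]; rewrite -(block_inj b b').
exact: ones_inj.
Qed.
End Blocks.

Lemma entry_of_ex (f : nat -> nat) : exists w, forall x, entry_of w x (f x).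
Proof.
pose start := fix start x := if x is x.+1 then (start x + f x).+1 else 0.
have start_le x d : start x <= start (x + d).
  by elim: d => [|d IH]; rewrite ?addn0 // addnS (leq_trans IH) //= ltnW //
     ltnS leq_addr.
have start_lt x y : x < y -> start x + f x < start y.
  by move=> xy; have := start_le x.+1 (y - x.+1); rewrite subnKC.
(* The zeros are exactly the ends of the blocks. *)
pose w p := ~~ `[< exists x, p = start x + f x >].
have wN x : ~~ w (start x + f x) by rewrite negbK; apply/asboolP; exists x.
have wY x : ones w (start x) (f x).
  move=> k kl; apply/asboolP => -[y]; case: (ltngtP x y) => [lt|lt|<-]; last by lia.
    by have := start_le x (y - x); have := start_lt _ _ lt; rewrite subnKC; lia.
  by have := start_lt _ _ lt; lia.
have wb x : block w x (start x).
  by elim: x => [|x IH]; [exact: block0 | exact: blockS].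
by exists w => x; exists (start x).
Qed.

Section Relational.
Variables (I : Type) (w : I -> nat -> bool) (N x : nat).

(** A tape with finitely many zeros encodes only a partial function, so evaluation is a relation. *)
Fixpoint rval (t : nterm I) (v : nat) : Prop :=
  match t with
  | nX => v = x
  | nN => v = N
  | nO => v = 0
  | nS t => exists2 u, rval t u & v = u.+1
  | nF i t => exists2 u, rval t u & entry_of (w i) u v
  end.

Fixpoint rsat (p : npos I) : Prop :=
  match p with
  | n_eq t u => exists2 v, rval t v & rval u v
  | n_and p q => rsat p /\ rsat q
  | n_or p q => rsat p \/ rsat q
  end.

Lemma rsat_nsat (f : I -> nat -> nat) p :
  (forall i u v, entry_of (w i) u v -> f i u = v) -> rsat p -> nsat f N x p.
Proof.
move=> fw; have val t v : rval t v -> nval f N x t = v.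
  by elim: t v => [|||t IH|i t IH] v //= [u /IH-> //]; exact: fw.
by elim: p => /= [t u [v /val -> /val ->]|p IHp q IHq [/IHp ? /IHq]
    |p IHp q IHq [/IHp|/IHq]];
  [| |left|right].
Qed.

Lemma nsat_rsat (f : I -> nat -> nat) p :
  (forall i u, entry_of (w i) u (f i u)) -> nsat f N x p -> rsat p.
Proof.
move=> fw; have val t : rval t (nval f N x t).
  by elim: t => [|||t IH|i t IH] //=; [exists (nval f N x t) | exists (nval f N x t)].
elim: p => /= [t u e|p IHp q IHq [/IHp ? /IHq]|p IHp q IHq [/IHp|/IHq]] //;
  by [exists (nval f N x t); rewrite // e|left|right].
Qed.
End Relational.

Lemma nsat_oracle (I : Type) N (p : npos I) :
  (exists f, forall x, nsat f N x p) <-> (exists w, forall x, rsat w N x p).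
Proof.
split=> [[f fP]|[w wP]].
  have /choice[w wP] i := entry_of_ex (f i).
  by exists w => x; exact: nsat_rsat (fP x).
(* Undefined entries become 0; this is harmless because [rsat] rests only on values that exist. *)
have val i u : {v | forall v', entry_of (w i) u v' -> v = v'}.
  apply: cid; have [[v uv]|nuv] := pselect (exists v, entry_of (w i) u v).
    by exists v => v'; exact: entry_of_inj.
  by exists 0 => v' uv'; case: nuv; exists v'.
exists (fun i u => sval (val i u)) => x.
by apply: rsat_nsat (wP x) => i u v; exact: (svalP (val i u)).
Qed.

(** * Programs checking one instance of a normal form *)

Section Checker.
Variables (I : Type) (O : I -> nat -> bool).
Local Notation sem := (sem O).
Local Notation star := (@star).
Infix ";;" := (@Seq I) (at level 61, right associativity).

Fixpoint writes (p : prog I) (r : reg) : bool :=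
  match p with
  | Atom (Inc r') | Atom (Decr r') | Atom (Clear r') | Atom (Copy r' _) => r == r'
  | Atom _ => false
  | Seq p q | Alt p q => writes p r || writes q r
  | Star p => writes p r
  end.

Lemma sem_frame p r s s' : sem p s s' -> ~~ writes p r -> s' r = s r.
Proof.
elim: p s s' => [a|p IHp q IHq|p IHp q IHq|p IH] s s' /=.
- by case: a => [r'|r'|r'|r'|r' r''|r' r''|i r' b|] [_ ->] //= /upd_other.
- by move=> [s1 /IHp ps /IHq qs]; rewrite negb_or => /andP[/ps <- /qs].
- by rewrite negb_or => -[/IHp ps|/IHq qs] /andP[]; [move=> /ps|move=> _ /qs].
- by elim=> // {}s s1 {}s' /IH ps _ IHs np; rewrite IHs // ps.
Qed.

Lemma star_inv (R : store -> store -> Prop) (Q : store -> Prop) s s' :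
  (forall s s', Q s -> R s s' -> Q s') -> star R s s' -> Q s -> Q s'.
Proof. by move=> QR; elim=> // {}s s1 {}s' r _ IH /QR/(_ r). Qed.

Lemma star_cat (R : store -> store -> Prop) s s1 s' :
  star R s s1 -> star R s1 s' -> star R s s'.
Proof. by elim=> // {}s s2 {}s1 r _ IH /IH; exact: starS. Qed.

Lemma star1 (R : store -> store -> Prop) s s' : R s s' -> star R s s'.
Proof. by move=> r; apply: starS r (star0 _ _). Qed.

(** The loop may stop too early, but the test for a zero that follows it in [lookup] then fails. *)
Definition scan i : prog I := Star (Atom (Read i rP true) ;; Atom (Inc I rP)).

(* [lookup i d] replaces the content [x] of [d] by the length of block [x] of
   track [i]. *)
Definition lookup i (d : reg) : prog I :=
  Atom (Clear I rP) ;;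
  Star (Atom (Decr I d) ;; scan i ;; Atom (Read i rP false) ;; Atom (Inc I rP)) ;;
  Atom (Zero I d) ;;
  Star (Atom (Read i rP true) ;; Atom (Inc I rP) ;; Atom (Inc I d)) ;;
  Atom (Read i rP false).

Fixpoint eval (t : nterm I) (d : reg) : prog I :=
  match t with
  | nX => Atom (Copy I d rX)
  | nN => Atom (Copy I d rN)
  | nO => Atom (Clear I d)
  | nS t => eval t d ;; Atom (Inc I d)
  | nF i t => eval t d ;; lookup i d
  end.

Fixpoint check (p : npos I) : prog I :=
  match p with
  | n_eq t u => eval t rA ;; eval u rB ;; Atom (Same I rA rB)
  | n_and p q => check p ;; check q
  | n_or p q => Alt (check p) (check q)
  end.

Lemma writes_eval t d r : writes (eval t d) r -> (r == d) || (r == rP).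
Proof.
elim: t => [|||t IH|i t IH] /=; rewrite ?orbF; try by move->.
  by move=> /orP[/IH|->].
by move=> /orP[/IH //|]; do ?[case/orP]; move=> ->; rewrite ?orbT.
Qed.

Lemma writes_check p r : writes (check p) r -> [|| r == rA, r == rB | r == rP].
Proof.
elim: p => [t u|p IHp q IHq|p IHp q IHq] /=; try by move=> /orP[/IHp|/IHq].
by rewrite orbF => /orP[] /writes_eval /orP[] ->; rewrite ?orbT.
Qed.

Lemma scan_sound i s s' : sem (scan i) s s' ->
  exists l, s' rP = s rP + l /\ ones (O i) (s rP) l.
Proof.
move=> st.
pose Q s' := exists l, s' rP = s rP + l /\ ones (O i) (s rP) l.
apply: (star_inv (Q := Q) _ st); last by exists 0; rewrite addn0.
move=> s1 s2 [l [s1E o]] /= [s3 [/eqP t ->] [_ ->]].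
exists l.+1; rewrite /= upd_same s1E addnS; split=> // k.
by rewrite ltnS leq_eqVlt => /orP[/eqP->|/o //]; rewrite -s1E.
Qed.

Lemma scan_complete i s l : ones (O i) (s rP) l ->
  exists s', sem (scan i) s s' /\ s' rP = s rP + l.
Proof.
elim: l => [|l IH] o; first by exists s; rewrite addn0; split=> //; exact: star0.
have [s1 [st s1P]] : exists s', sem (scan i) s s' /\ s' rP = s rP + l.
  by apply: IH => k kl; apply: o; rewrite ltnS ltnW.
exists (upd s1 rP (s1 rP).+1); split; last by rewrite upd_same s1P addnS.
apply: star_cat st _; apply: star1; exists s1 => //; split=> //=.
by rewrite s1P o.
Qed.

Variable d : reg.
Hypothesis dP : d != rP.

Lemma lookup_sound i s s' : sem (lookup i d) s s' -> entry_of (O i) (s d) (s' d).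
Proof.
case=> s1 [_ ->] [s2 st2 [s3 [/eqP z e3] [s4 st4 [/eqP rd ->]]]]; subst s3.
have [p b pE] : exists2 p, block (O i) (s d) p & s2 rP = p.
  (* Invariant of the first loop: [rP] is at the start of block [k] after [k] decrements of [d]. *)
  pose Q t := exists k, block (O i) k (t rP) /\ k + t d = s d.
  suff [k [b]] : Q s2 by rewrite z addn0 => <-; exists (s2 rP).
  apply: (star_inv (Q := Q)) st2 _; last first.
    by exists 0; rewrite /= upd_same upd_other //; split; first exact: block0.
  move=> t t' [k [b e]] [t1 [/= dpos t1E] [t2 sc [t3 [/eqP r0 e3] [_ ->]]]].
  subst t3; have [l [t2E o]] := scan_sound sc.
  have t2d : t2 d = t1 d by exact: (sem_frame (p := scan i) sc).
  have t1P : t1 rP = t rP by rewrite t1E upd_other // eq_sym.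
  have t1d : t1 d = (t d).-1 by rewrite t1E upd_same.
  exists k.+1; rewrite /= upd_same upd_other // t2d t1d addSnnS prednK //.
  rewrite t1P in o t2E; split=> //; rewrite t2E; apply: blockS => //.
  by rewrite -t2E r0.
(* Invariant of the second loop: [d] counts the ones passed since the start [p] of the block. *)
pose Q t := t rP = p + t d /\ ones (O i) p (t d).
suff [e o] : Q s4 by exists p; split=> //; rewrite -e rd.
apply: (star_inv (Q := Q)) st4 _; last by rewrite /Q /= z addn0.
move=> t t' [e o] [t1 [/eqP r1 e1] [t2 [_ ->] [_ ->]]]; subst t1 => /=.
rewrite /Q upd_same !(upd_other _ _ dP) upd_other 1?eq_sym // upd_same e addnS.
split=> // k; rewrite ltnS leq_eqVlt => /orP[/eqP->|/o //].
by rewrite -e.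
Qed.

Lemma lookup_complete i s y : entry_of (O i) (s d) y ->
  exists s', sem (lookup i d) s s'.
Proof.
move=> [p [b o n]].
have Pd : rP != d by rewrite eq_sym.
pose body := Atom (Decr I d) ;; scan i ;; Atom (Read i rP false) ;; Atom (Inc I rP).
have find x q e s1 : block (O i) x q -> s1 rP = 0 -> s1 d = x + e ->
    exists s2, [/\ star (sem body) s1 s2, s2 rP = q & s2 d = e].
  move=> bx; elim: bx e s1 => [|{}x {}q l bx IH ol nl] e s1 s1P s1d.
    by exists s1; split=> //; exact: star0.
  have [s2 [st s2P s2d]] := IH e.+1 s1 s1P (etrans s1d (addSnnS _ _)).
  pose s3 := upd s2 d (s2 d).-1.
  have s3P : s3 rP = q by rewrite /s3 upd_other.
  have [s4 [sc s4P]] : exists s', sem (scan i) s3 s' /\ s' rP = s3 rP + l.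
    by apply: scan_complete; rewrite s3P.
  have s4d : s4 d = s3 d by exact: (sem_frame (p := scan i) sc).
  exists (upd s4 rP (s4 rP).+1); split.
  - apply: star_cat st _; apply: star1.
    exists s3; first by split; rewrite //= s2d.
    exists s4 => //; exists s4 => //; split=> //=.
    by rewrite s4P s3P (negPf nl).
  - by rewrite upd_same s4P s3P.
  - by rewrite upd_other // s4d /s3 upd_same s2d.
pose s1 := upd s rP 0.
have [s2 [st s2P s2d]] : exists s2,
    [/\ star (sem body) s1 s2, s2 rP = p & s2 d = 0].
  by apply: (find (s d)); rewrite /s1 ?upd_same ?upd_other ?addn0.
pose copy := Atom (Read i rP true) ;; Atom (Inc I rP) ;; Atom (Inc I d).
have [s3 [st' s3P]] : exists s3, star (sem copy) s2 s3 /\ s3 rP = p + y.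
  elim: y o {n} => [|y IH] o; first by exists s2; rewrite addn0; split=> //; exact: star0.
  have [s3 [st' s3P]] : exists s3, star (sem copy) s2 s3 /\ s3 rP = p + y.
    by apply: IH => k ky; apply: o; rewrite ltnS ltnW.
  pose s4 := upd s3 rP (s3 rP).+1.
  exists (upd s4 d (s4 d).+1); split; last by rewrite upd_other // /s4 upd_same s3P addnS.
  apply: star_cat st' _; apply: star1; exists s3; last by exists s4.
  by split=> //=; rewrite s3P o.
exists s3; exists s1 => //; exists s2 => //; exists s2; first by split=> //=; apply/eqP.
by exists s3 => //; split=> //=; rewrite s3P (negPf n).
Qed.

Lemma eval_frame t s s' r : sem (eval t d) s s' -> r != d -> r != rP ->
  s' r = s r.
Proof.
move=> st rd rP'; apply: (sem_frame st); apply/negP => /writes_eval.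
by rewrite (negPf rd) (negPf rP').
Qed.

Lemma eval_sound t s s' : sem (eval t d) s s' -> rval O (s rN) (s rX) t (s' d).
Proof.
elim: t s' => [|||t IH|i t IH] s' /=; try by move=> [_ ->]; rewrite /= upd_same.
  by move=> [s1 /IH r [_ ->]]; exists (s1 d); rewrite //= upd_same.
by move=> [s1 /IH r /(lookup_sound (i := i)) e]; exists (s1 d).
Qed.

Lemma rval_inj (w : I -> nat -> bool) N x t v v' :
  rval w N x t v -> rval w N x t v' -> v = v'.
Proof.
elim: t v v' => [|||t IH|i t IH] v v' /=; try by move=> -> ->.
  by move=> [u r ->] [u' r' ->]; rewrite (IH _ _ r r').
by move=> [u r e] [u' r' e']; move: e'; rewrite -(IH _ _ r r'); exact: entry_of_inj.
Qed.

Lemma eval_complete t v s : rval O (s rN) (s rX) t v ->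
  exists s', sem (eval t d) s s'.
Proof.
elim: t v => [|||t IH|i t IH] v /=; try by move=> _; eexists; split.
  by move=> [u /IH[s1 st] _]; eexists; exists s1.
move=> [u r e]; have [s1 st] := IH _ r.
have e1 : entry_of (O i) (s1 d) v by rewrite (rval_inj (eval_sound st) r).
by have [s2 st2] := lookup_complete e1; exists s2, s1.
Qed.
End Checker.

Section Check.
Variables (I : Type) (O : I -> nat -> bool).
Implicit Types p : npos I.

Lemma check_frame p s s' r : sem O (check p) s s' -> (r == rX) || (r == rN) ->
  s' r = s r.
Proof.
move=> st h; apply: (sem_frame st); apply/negP => /writes_check; move: h.
by do ?[case/orP]; move=> /eqP->.
Qed.

Lemma check_sound p s s' : sem O (check p) s s' -> rsat O (s rN) (s rX) p.
Proof.
elim: p s s' => [t u|p IHp q IHq|p IHp q IHq] s s' /=.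
- move=> [s1 ts [s2 us [/eqP e _]]]; exists (s1 rA); first exact: eval_sound ts.
  have := eval_sound (d := rB) isT us.
  by rewrite -e (eval_frame us) // !(eval_frame (r := rN) ts, eval_frame (r := rX) ts).
- move=> [s1 ps qs]; split; first exact: IHp ps.
  by have := IHq _ _ qs; rewrite !(check_frame ps).
- by move=> [/IHp|/IHq]; [left|right].
Qed.

Lemma check_complete p s : rsat O (s rN) (s rX) p -> exists s', sem O (check p) s s'.
Proof.
elim: p s => [t u|p IHp q IHq|p IHp q IHq] s /=.
- move=> [v tv uv]; have [s1 ts] := eval_complete (d := rA) isT tv.
  have uv1 : rval O (s1 rN) (s1 rX) u v.
    by rewrite !(eval_frame (r := rN) ts, eval_frame (r := rX) ts).
  have [s2 us] := eval_complete (d := rB) isT uv1.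
  exists s2, s1 => //; exists s2 => //; split=> //=; apply/eqP.
  rewrite (eval_frame us) // (rval_inj (eval_sound (d := rA) isT ts) tv).
  apply: rval_inj uv _; have := eval_sound (d := rB) isT us.
  by rewrite !(eval_frame (r := rN) ts, eval_frame (r := rX) ts).
- move=> [/IHp[s1 ps] qs]; have [s2 qs2] : exists s2, sem O (check q) s1 s2.
    by apply: IHq; rewrite !(check_frame ps).
  by exists s2, s1.
- by move=> [/IHp|/IHq] [s' h]; exists s'; [left|right].
Qed.

Variable p : npos I.
Local Notation body := (check p).

(** The hub [None] of the loop is where the program flashes; its [Skip] is replaced by the passage
    to the next value of [rX]. *)
Definition loop_lab (c : ctl (Star body)) : act I :=
  if c is Some c then lab c else Inc I rX.

Definition init N : store := upd (fun=> 0) rN N.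

Definition loop_run N (q : nat -> ctl (Star body)) (s : nat -> store) :=
  [/\ q 0 = Some (entry body), s 0 = init N,
      forall t, step O (loop_lab (q t)) (s t) (s t.+1) /\ cnext (q t) (q t.+1) &
      forall t, exists u, t <= u /\ q u = None].

Lemma loop_run_sound N q s : loop_run N q s -> forall x, rsat O N x p.
Proof.
move=> [q0 s0 st acc].
(* Until its first visit to the hub the loop executes the body, and it enters the hub only from the
   exit of the body. *)
have seg d t c : q t = Some c -> q (t + d) = None ->
    exists2 u, q u = None & run_to O c (s t) (s u).
  elim: d t c => [|d IH] t c qt; first by rewrite addn0 qt.
  rewrite -addSnnS; have [stt] := st t; rewrite qt in stt *.
  case E: (q t.+1) => [c1|] /= nc qd.
    have [u qu r] := IH _ _ E qd; exists u => //.
    exact: (execS (l := @lab I body)) stt nc r.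
  exists t.+1 => //; rewrite (eqP nc) in stt *.
  exact: (exec1 (l := @lab I body)).
have main x : exists t, [/\ q t = Some (entry body), s t rX = x & s t rN = N].
  elim: x => [|x [t [qt sX sN]]]; first by exists 0; rewrite s0.
  have [u [tu qu]] := acc t; rewrite -(subnKC tu) in qu.
  have [v qv /semP r] := seg _ _ _ qt qu.
  have [[_ sv]] := st v; rewrite qv /= in sv *.
  case E: (q v.+1) => [c|] //= /eqP cE; exists v.+1; rewrite E cE sv.
  by rewrite upd_same upd_other // !(check_frame r) // sX.
move=> x; have [t [qt <- <-]] := main x.
have [u [tu qu]] := acc t; rewrite -(subnKC tu) in qu.
by have [v _ /semP] := seg _ _ _ qt qu; exact: check_sound.
Qed.

(** A certificate that the hub can be reached in a given number of steps with [rN] intact. Following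
    decreasing certificates resolves the nondeterminism and leads back to the hub infinitely
    often. *)
Inductive dist N : nat -> ctl (Star body) -> store -> Prop :=
| dist0 s : s rN = N -> dist N 0 None s
| distS d c s c1 s1 : step O (loop_lab c) s s1 -> cnext c c1 -> dist N d c1 s1 ->
    dist N d.+1 c s.

Lemma loop_run_complete N : (forall x, rsat O N x p) -> exists q s, loop_run N q s.
Proof.
move=> sat.
have run_dist c s s' : run_to O c s s' -> s' rN = N -> exists d, dist N d (Some c) s.
  rewrite /run_to; move E: (exit body) => e r; elim: r E => {c s e s'}.
    move=> c s s' st E sN; exists 1; apply: (distS (c := Some c) st _ (dist0 sN)).
    by rewrite /= E.
  move=> c s s1 c1 e s' st nc _ IH E /(IH E)[d dd]; exists d.+1.
  exact: (distS (c := Some c) (c1 := Some c1) st nc dd).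
have entry_dist s : s rN = N -> exists d, dist N d (Some (entry body)) s.
  move=> sN; have [s' st] : exists s', sem O body s s'.
    by apply: check_complete; rewrite sN.
  by apply: (run_dist _ _ s'); [exact/semP | rewrite (check_frame st)].
have advance (u : nat * ctl (Star body) * store) : dist N u.1.1 u.1.2 u.2 ->
    exists v : nat * ctl (Star body) * store,
    [/\ dist N v.1.1 v.1.2 v.2, step O (loop_lab u.1.2) u.2 v.2,
        cnext u.1.2 v.1.2 & u.1.1 = 0 \/ v.1.1 < u.1.1].
  case: u => [[d c] s] /= [{}s sN|{}d {}c {}s c1 s1 st nc dd].
    have [d' dd'] : exists d, dist N d (Some (entry body)) (upd s rX (s rX).+1).
      by apply: entry_dist; rewrite upd_other.
    by exists (d', Some (entry body), upd s rX (s rX).+1); split=> //=; left.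
  by exists (d, c1, s1); split=> //=; right.
have [d0 dd0] : exists d, dist N d (Some (entry body)) (init N).
  by apply: entry_dist; rewrite /init upd_same.
have adv (u : {u : nat * ctl (Star body) * store | dist N u.1.1 u.1.2 u.2}) :
    {v : {u : nat * ctl (Star body) * store | dist N u.1.1 u.1.2 u.2} |
    [/\ step O (loop_lab (sval u).1.2) (sval u).2 (sval v).2,
        cnext (sval u).1.2 (sval v).1.2 &
        (sval u).1.1 = 0 \/ (sval v).1.1 < (sval u).1.1]}.
  apply: cid; case: u => u du; have [v [dv st nc dec]] := advance u du.
  by exists (exist _ v dv).
pose u := fix u t := if t is t.+1 then sval (adv (u t)) else
  exist (fun u => dist N u.1.1 u.1.2 u.2) (d0, Some (entry body), init N) dd0.
have uS t := svalP (adv (u t)).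
exists (fun t => (sval (u t)).1.2), (fun t => (sval (u t)).2); split=> //.
  by move=> t; have [] := uS t.
(* The distance decreases until it is 0, which happens only at the hub. *)
move=> t; have [n] := ubnP (sval (u t)).1.1; elim: n t => // n IH t lt.
have [_ _ [d0'|dlt]] := uS t.
  exists t; split=> //; have := svalP (u t); rewrite d0' => dd.
  by inversion dd.
have [v [tv qv]] := IH t.+1 (leq_trans dlt lt).
by exists v; rewrite ltnW.
Qed.

End Check.

(** * Tilings simulating programs *)

(** As [tile_code], but with plain numbers for states, so that the tile lists for all [n] share one
    type. *)
Definition ntile_code (t : tile bool nat) : nat :=
  let: (x1, x2, x3, x4) := t in
  CodeSeq.code [:: symbol_code x1.1; x1.2; symbol_code x2.1; x2.2;
                   symbol_code x3.1; x3.2; symbol_code x4.1; x4.2].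

Lemma ntile_code_inj : injective ntile_code.
Proof.
move=> [[[[a1 q1] [a2 q2]] [a3 q3]] [a4 q4]] [[[[b1 r1] [b2 r2]] [b3 r3]] [b4 r4]].
move=> /(can_inj CodeSeq.codeK) [].
move=> /symbol_code_inj -> -> /symbol_code_inj -> ->.
by move=> /symbol_code_inj -> -> /symbol_code_inj -> ->.
Qed.

Definition tile_at (Q : Type) (p : nat * nat -> option bool) (rho : nat * nat -> Q)
    i j : tile bool Q :=
  ((p (i, j.+1), rho (i, j.+1)), (p (i.+1, j.+1), rho (i.+1, j.+1)),
   (p (i, j), rho (i, j)), (p (i.+1, j), rho (i.+1, j))).

Lemma index_languageE (n : nat) (f : seq nat) (ts : seq (tile bool nat)) p :
  buchi_language (tiling_of_index
    (CodeSeq.code [:: n, CodeSeq.code f & map ntile_code ts])) p <->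
  is_picture p /\ exists rho : nat * nat -> nat,
    [/\ forall v, rho v < n, forall i j, tile_at p rho i j \in ts &
        infinite_set [set v | rho v \in f]].
Proof.
rewrite /buchi_language /is_accepting /is_run /tiling_of_index CodeSeq.codeK /=.
rewrite drop0 CodeSeq.codeK; split=> -[pp [rho]].
  move=> [run acc]; split=> //; exists (fun v => val (rho v)).
  split=> [v|i j|] //; first exact: ltn_ord.
  by rewrite -(mem_map ntile_code_inj); exact: run.
move=> [lt run acc]; split=> //; exists (fun v => Ordinal (lt v)); split=> // i j.
by have := run i j; rewrite -(mem_map ntile_code_inj).
Qed.

Section CellStep.
Variable I : finType.
Local Notation marks := {ffun reg -> bool}.

(* A row is a configuration: cell [i] has the mark of register [r] iff [r]
   contains [i], and bit [i] of every track.  The cells [m3 m4] of a row are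
   below the cells [m1 m2] of the next row. *)
Definition cell_step (a : act I) (left : bool) (m1 m2 m3 m4 : marks)
    (o : {ffun I -> bool}) : bool :=
  let others r := [forall r', (r' != r) ==> (m1 r' == m3 r')] in
  match a with
  | Inc r => [&& m2 r == m3 r, left ==> ~~ m1 r & others r]
  | Decr r => [&& m1 r == m4 r, left ==> ~~ m3 r & others r]
  | Zero r => (left ==> m3 r) && (m1 == m3)
  | Clear r => (m1 r == left) && others r
  | Copy r r' => (m1 r == m3 r') && others r
  | Same r r' => (m3 r == m3 r') && (m1 == m3)
  | Read i r b => (m3 r ==> (o i == b)) && (m1 == m3)
  | Skip => m1 == m3
  end.

(** In row [m] each register marks a single cell. [Inc] and [Decr] move a mark by comparing cells
    diagonally, tests bite at the marked cell, and [left] supplies the conditions in column 0. *)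
Lemma cell_stepP (a : act I) (s : store) (m m' : nat -> marks)
    (o : nat -> {ffun I -> bool}) :
  (forall i r, m i r = (i == s r)) ->
  (forall i, cell_step a (i == 0) (m' i) (m' i.+1) (m i) (m i.+1) (o i)) <->
  (guard (fun k i => o i k) a s /\ forall i r, m' i r = (i == effect a s r)).
Proof.
move=> ms.
have allP : (forall i, m' i == m i) <-> (forall i r, m' i r = (i == s r)).
  split=> [e i r|e i]; first by rewrite (eqP (e i)).
  by apply/eqP/ffunP => r; rewrite e ms.
have updP r v : (forall i, m' i r = (i == v)) /\
      (forall i, [forall r', (r' != r) ==> (m' i r' == m i r')]) <->
    (forall i r', m' i r' = (i == upd s r v r')).
  split=> [[mr mo] i r'|mu].
    rewrite /upd; case: (eqVneq r' r) => [->|ne]; first exact: mr.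
    by have /forallP/(_ r') := mo i; rewrite ne /= ms => /eqP.
  split=> i; first by rewrite mu upd_same.
  by apply/forallP => r'; apply/implyP => ne; rewrite mu upd_other // ms.
case: a => [r|r|r|r|r r'|r r'|k r b|] /=.
- rewrite -updP; split=> [h|[_ [mr mo]] i].
    split=> //; split=> i; last by case/and3P: (h i).
    case: i => [|i]; first by have /and3P[_ /= /negPf-> _] := h 0.
    by have /and3P[/eqP-> _ _] := h i; rewrite ms eqSS.
  by rewrite mo !mr ms eqSS eqxx andbT /=; case: eqP => // ->.
- have sE : 0 < s r -> forall i, (i.+1 == s r) = (i == (s r).-1).
    by move=> s0 i; rewrite -{1}(prednK s0) eqSS.
  rewrite -updP; split=> [h|[s0 [mr mo]] i].
    have s0 : 0 < s r.
      by have /and3P[_ /= + _] := h 0; rewrite ms eq_sym lt0n.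
    split=> //; split=> i; last by case/and3P: (h i).
    by have /and3P[/eqP-> _ _] := h i; rewrite ms sE.
  rewrite mo mr !ms sE // eqxx andbT /=.
  by case: eqP => // ->; rewrite eq_sym -lt0n.
- split=> [h|[/eqP s0 /allP h] i].
    split; first by have /andP[/=] := h 0; rewrite ms eq_sym.
    by apply/allP => i; case/andP: (h i).
  by rewrite h ms s0 andbT implybb.
- rewrite -updP; split=> [h|[_ [mr mo]] i]; last by rewrite mr mo eqxx.
  by split=> //; split=> i; case/andP: (h i) => [/eqP].
- rewrite -updP; split=> [h|[_ [mr mo]] i]; last by rewrite mr ms mo eqxx.
  by split=> //; split=> i; case/andP: (h i) => [/eqP + _] //; rewrite ms.
- split=> [h|[/eqP ss /allP h] i]; last by rewrite h !ms ss eqxx.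
  split; last by apply/allP => i; case/andP: (h i).
  by have /andP[/eqP] := h (s r); rewrite !ms eqxx => <-.
- split=> [h|[/eqP ob /allP h] i].
    split; last by apply/allP => i; case/andP: (h i).
    by have /andP[] := h (s r); rewrite ms eqxx.
  by rewrite h ms andbT; apply/implyP => /eqP->; rewrite ob.
- by split=> [/allP|[_ /allP]].
Qed.
End CellStep.

(** * The tiling system of a machine *)

Section MachineTiling.
Variables (I G : finType) (glab : G -> act I) (gnext : rel G).
Variables (gstart gacc gmode : pred G).
Hypothesis gmode_next : forall c d, gnext c d -> gmode c = gmode d.

Definition cell := (G * {ffun reg -> bool} * {ffun I -> bool})%type.
Local Notation ctlc q := (q.1.1 : G).
Local Notation markc q := (q.1.2 : {ffun reg -> bool}).
Local Notation bitc q := (q.2 : {ffun I -> bool}).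
Local Notation K := #|[the finType of cell]|.

Definition enc (q : cell) : nat := enum_rank q.

Lemma enc_inj : injective enc.
Proof. by move=> q q' /val_inj /enum_rank_inj. Qed.

(** Bits are constant along columns, so the tapes never change, and the control state is constant
    along rows. Apart from the border, letters are restricted only in mode [gmode], which enforces
    [stairs]. *)
Definition inner (t : tile bool cell) : bool :=
  let: ((x1, q1), (x2, q2), (x3, q3), (x4, q4)) := t in
  [&& x4 != None, gnext (ctlc q3) (ctlc q1), ctlc q3 == ctlc q4,
      bitc q1 == bitc q3,
      cell_step (glab (ctlc q3)) (x3 == None)
        (markc q1) (markc q2) (markc q3) (markc q4) (bitc q3) &
      gmode (ctlc q3) ==>
        ((x3 != None) ==> (x3 == x4)) && ((x4 == Some false) ==> (x2 == Some false))].

(* The bottom row counts down, K + (n + 2), ..., K + 1, K, K, ..., and places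
   the mark of the input register above its first occurrence of K.  The offset
   2 keeps that mark off the two leftmost cells, so that the shape of the
   corner tiles does not depend on n. *)
Definition bottom (corner one : bool)
    (u : (option bool * cell) * (option bool * cell)) : bool :=
  let: ((x1, q1), (x2, q2)) := u in
  [&& (x1 == None) == corner, x2 != None, gstart (ctlc q1),
      markc q2 == [ffun r => (r == rN) && one] &
      corner ==> (markc q1 == [ffun r => r != rN])].

(** States from [K] on are reserved for the bottom row, those below encode cells; as [0.-1] is 0,
    the countdown stays at [K]. *)
Definition bottom_tile r (u : (option bool * cell) * (option bool * cell)) :
    tile bool nat :=
  ((u.1.1, enc u.1.2), (u.2.1, enc u.2.2), (None, K + r), (None, K + r.-1)).

Definition base_tiles : seq (tile bool nat) :=
  [seq bottom_tile 1 u | u <- enum (bottom false true)] ++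
  [seq bottom_tile 0 u | u <- enum (bottom false false)] ++
  [seq tile_map enc t | t <- enum inner].

(** The countdown values are added one at a time, which makes the code of the list primitive
    recursive in [n]. *)
Fixpoint row_tiles n : seq (tile bool nat) :=
  if n is n.+1 then
    [seq bottom_tile n.+2 u | u <- enum (bottom false false)] ++ row_tiles n
  else base_tiles.

Definition machine_tiles n : seq (tile bool nat) :=
  [seq bottom_tile n.+2 u | u <- enum (bottom true false)] ++ row_tiles n.

(** The mark of [rX] singles out one cell of each accepting row; without it a single accepting row
    would contain infinitely many final states. *)
Definition final_cells : seq nat :=
  [seq enc q | q <- enum [pred q : cell | gacc (ctlc q) && markc q rX]].

Definition machine_index n :=
  CodeSeq.code [:: K + n.+3, CodeSeq.code final_cells
    & map ntile_code (machine_tiles n)].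

Lemma mem_base_tiles t : t \in base_tiles <->
  (exists r u, [/\ r <= 1, bottom false (r == 1) u & t = bottom_tile r u]) \/
  exists2 t', inner t' & t = tile_map enc t'.
Proof.
rewrite /base_tiles !mem_cat; split=> [/or3P[]/mapP[u]|].
- by rewrite mem_enum => hu ->; left; exists 1, u.
- by rewrite mem_enum => hu ->; left; exists 0, u.
- by rewrite mem_enum => hu ->; right; exists u.
move=> [[r [u [r1 hu ->]]]|[t' ht ->]].
  by case: r r1 hu => [|[]] // _ hu; rewrite !(map_f (bottom_tile _)) ?orbT // mem_enum.
by rewrite (map_f (tile_map enc)) ?orbT // mem_enum.
Qed.

Lemma mem_row_tiles n t : t \in row_tiles n <->
  (exists r u, [/\ r <= n.+1, bottom false (r == 1) u & t = bottom_tile r u]) \/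
  exists2 t', inner t' & t = tile_map enc t'.
Proof.
elim: n => [|n IH] /=; first exact: mem_base_tiles.
rewrite mem_cat; split=> [/orP[/mapP[u]|/IH[[r [u [rn hu ->]]]|h]]|].
- by rewrite mem_enum => hu ->; left; exists n.+2, u.
- by left; exists r, u; rewrite leqW.
- by right.
move=> [[r [u [+ hu et]]]|h]; last by apply/orP; right; apply/IH; right.
rewrite leq_eqVlt ltnS => /orP[/eqP rn|rn]; apply/orP; [left|right].
  by rewrite et rn map_f // mem_enum; move: hu; rewrite rn.
by apply/IH; left; exists r, u.
Qed.

Lemma mem_machine_tiles n t : t \in machine_tiles n <->
  (exists r u, [/\ r <= n.+2, bottom (r == n.+2) (r == 1) u & t = bottom_tile r u]) \/
  exists2 t', inner t' & t = tile_map enc t'.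
Proof.
rewrite mem_cat; split=> [/orP[/mapP[u]|/mem_row_tiles[[r [u [rn hu ->]]]|h]]|].
- by rewrite mem_enum => hu ->; left; exists n.+2, u; rewrite eqxx.
- left; exists r, u; split=> //; first by rewrite ltnW.
  by rewrite ltn_eqF.
- by right.
move=> [[r [u [+ hu et]]]|h]; last by apply/orP; right; apply/mem_row_tiles; right.
rewrite leq_eqVlt => /orP[/eqP rn|rn]; apply/orP; [left|right].
  by rewrite et rn map_f // mem_enum; move: hu; rewrite rn eqxx.
by apply/mem_row_tiles; left; exists r, u; split=> //; rewrite ltn_eqF in hu.
Qed.

Definition machine_run N (O : I -> nat -> bool) (q : nat -> G) (s : nat -> store) :=
  [/\ gstart (q 0), s 0 = init N,
      forall t, step O (glab (q t)) (s t) (s t.+1) /\ gnext (q t) (q t.+1) &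
      forall t, exists u, t <= u /\ gacc (q u)].

(** Such a picture is determined by the height, finite or infinite, up to which its rows read
    [Some true]. *)
Definition stairs (p : nat * nat -> option bool) := forall i j,
  p (i.+1, j.+1) = p (i.+2, j.+1) /\
  (p (i.+1, j.+1) = Some false -> p (i.+1, j.+2) = Some false).

Lemma init_mark n i r : (i == init n.+2 r) =
  if i is i.+1 then (r == rN) && (n.+2 - i == 1) else r != rN.
Proof.
rewrite /init /upd; case: (eqVneq r rN) => _; case: i => [|i] //=.
by lia.
Qed.

Lemma mode_const q : (forall t, gnext (q t) (q t.+1)) ->
  forall t, gmode (q t) = gmode (q 0).
Proof. by move=> nx; elim=> // t <-; rewrite (gmode_next (nx t)). Qed.

Lemma machine_run_tiling n p O q s : is_picture p -> machine_run n.+2 O q s ->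
  (gmode (q 0) -> stairs p) -> buchi_language (tiling_of_index (machine_index n)) p.
Proof.
move=> pp [q0 s0 st acc] pst; apply/index_languageE; split=> //.
pose sigma (v : nat * nat) : cell :=
  (q v.2.-1, [ffun r => v.1 == s v.2.-1 r], [ffun k => O k v.1]).
pose rho (v : nat * nat) :=
  if v.2 is _.+1 then enc (sigma v) else K + (n.+2 - v.1).
have mc := mode_const (fun t => (st t).2).
have p0 i : p (i, 0) = None by apply/eqP; rewrite pp orbT.
exists rho; split.
- move=> [i [|t]]; first by rewrite /rho /= addnS ltnS leq_add2l leq_subr.
  by rewrite /rho (leq_trans (ltn_ord _)) // leq_addr.
- move=> i [|t]; apply/mem_machine_tiles; [left|right].
    exists (n.+2 - i), ((p (i, 1), sigma (i, 1)), (p (i.+1, 1), sigma (i.+1, 1))).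
    split; [exact: leq_subr| |by rewrite /bottom_tile /tile_at /rho /= !p0 -subnS].
    rewrite /= !pp orbF /= q0; apply/and4P; split=> //.
    + by apply/eqP; lia.
    + by apply/eqP/ffunP => r; rewrite !ffunE s0 init_mark.
    + apply/implyP => i0; apply/eqP/ffunP => r; rewrite !ffunE s0.
      by have -> : i = 0 by [lia]; rewrite init_mark.
  exists (tile_at p sigma i t.+1); last by [].
  have [[gd ef] nx] := st t.
  rewrite /= !pp nx eqxx /=; apply/and3P; split.
  + by apply/eqP/ffunP => k; rewrite !ffunE.
  + pose m t i := [ffun r => i == s t r]; pose o i := [ffun k => O k i].
    have ms i' r : m t i' r = (i' == s t r) by rewrite ffunE.
    rewrite orbF; have [_] := cell_stepP (glab (q t)) (m t.+1) o ms; apply.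
    split; last by move=> i' r; rewrite ffunE ef.
    by move: gd; case: (glab _) => //= k r b; rewrite ffunE.
  + apply/implyP; rewrite mc => /pst ps; apply/andP; split; apply/implyP.
      by rewrite orbF; case: i => // i _; apply/eqP; case: (ps i t).
    by move=> /eqP h; apply/eqP; case: (ps i t) => _; apply.
- apply: (unbounded_infinite (r := fun v : nat * nat => v.2)) => t.
  have [u [tu au]] := acc t; exists (s u rX, u.+1); rewrite /= leqW //; split=> //.
  by rewrite /rho /= (mem_map enc_inj) mem_enum inE /= au ffunE eqxx.
Qed.

Lemma tiling_machine_run n p : buchi_language (tiling_of_index (machine_index n)) p ->
  exists O q s, machine_run n.+2 O q s /\ (gmode (q 0) -> stairs p).
Proof.
move=> /index_languageE[pp [rho [_ run acc]]].
have p0 i : p (i, 0) = None by apply/eqP; rewrite pp orbT.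
(* Bottom tiles have the border symbol at the lower right and inner tiles a letter, so the bottom
   row is exactly where bottom tiles are used. *)
have inner_ex i t : exists2 t', inner t' & tile_at p rho i t.+1 = tile_map enc t'.
  have /mem_machine_tiles[[r [u [_ _ [_ _ _ _ _ _ e _]]]]|//] := run i t.+1.
  by have := pp i.+1 t.+1; rewrite e.
have bottom_ex i : exists r u, bottom (r == n.+2) (r == 1) u /\
    tile_at p rho i 0 = bottom_tile r u.
  have /mem_machine_tiles[[r [u [_ hu e]]]|] := run i 0; first by exists r, u.
  case=> [[[[[x1 q1] [x2 q2]] [x3 q3]] [x4 q4]]] /= /andP[nx4 _] [_ _ _ _ _ _ e _].
  by rewrite -e p0 in nx4.
have /choice[sg sgP] (v : nat * nat) : exists q, rho (v.1, v.2.+1) = enc q.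
  case: v => i [|t].
    by have [r [u [_ [_ e _ _ _ _]]]] := bottom_ex i; exists u.1.2.
  have [[[[[x1 q1] [x2 q2]] [x3 q3]] [x4 q4]] _ [_ e _ _ _ _ _ _]] := inner_ex i t.
  by exists q1.
have inn i t : inner ((p (i, t.+2), sg (i, t.+1)), (p (i.+1, t.+2), sg (i.+1, t.+1)),
    (p (i, t.+1), sg (i, t)), (p (i.+1, t.+1), sg (i.+1, t))).
  have [[[[[x1 q1] [x2 q2]] [x3 q3]] [x4 q4]] + e] := inner_ex i t; move: e.
  rewrite /tile_at (sgP (i, t.+1)) (sgP (i.+1, t.+1)) (sgP (i, t)) (sgP (i.+1, t)).
  by move=> [-> /enc_inj-> -> /enc_inj-> -> /enc_inj-> -> /enc_inj->].
have bot i : rho (i, 0) = K + (n.+2 - i) /\ bottom (i == 0) (n.+2 - i == 1)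
    ((p (i, 1), sg (i, 0)), (p (i.+1, 1), sg (i.+1, 0))).
  have botr r : rho (i, 0) = K + r -> bottom (r == n.+2) (r == 1)
    ((p (i, 1), sg (i, 0)), (p (i.+1, 1), sg (i.+1, 0))).
    have [r' [[[x1 q1] [x2 q2]] [+ e]]] := bottom_ex i; move: e.
    rewrite /tile_at (sgP (i, 0)) (sgP (i.+1, 0)).
    by move=> [-> /enc_inj-> -> /enc_inj-> _ -> _ _] hb /addnI <-.
  suff e : rho (i, 0) = K + (n.+2 - i).
    split=> //; have -> : (i == 0) = (n.+2 - i == n.+2) by apply/eqP/eqP; lia.
    exact: botr.
  elim: i {botr} => [|i IH].
    (* The border symbol at [(0, 1)] forces a corner tile, hence the start value [n.+2] of the
       countdown. *)
    have [r [[[x1 q1] [x2 q2]] [+ [e1 _ _ _ _ e _ _]]]] := bottom_ex 0.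
    by rewrite /= -e1 pp e /= => /andP[/eqP/esym/eqP-> _]; rewrite subn0.
  have [r [_ [_ [_ _ _ _ _ e _ e']]]] := bottom_ex i.
  by rewrite e' subnS; congr (K + _.-1); move: e; rewrite IH => /addnI.
pose q t := ctlc (sg (0, t)).
have ctl_row i t : ctlc (sg (i, t)) = q t.
  by elim: i => // i <-; have /and5P[_ _ /eqP-> _] := inn i t.
pose o i := bitc (sg (i, 0)).
have bit_col i t : bitc (sg (i, t)) = o i.
  by elim: t => // t <-; have /and5P[_ _ _ /eqP-> _] := inn i t.
(* Effects are deterministic, so the control states alone determine the stores; [marks] shows that
   the rows encode them and that all guards hold. *)
pose s := fix s t := if t is t.+1 then effect (glab (q t)) (s t) else init n.+2.
pose O (k : I) i := o i k.
have marks t : (forall i r, markc (sg (i, t)) r = (i == s t r)) /\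
    (forall i r, markc (sg (i, t.+1)) r = (i == s t.+1 r)) /\ guard O (glab (q t)) (s t).
  have next t' : (forall i r, markc (sg (i, t')) r = (i == s t' r)) ->
      (forall i r, markc (sg (i, t'.+1)) r = (i == s t'.+1 r)) /\
      guard O (glab (q t')) (s t').
    move=> ms; have [+ _] := cell_stepP (glab (q t'))
      (fun i => markc (sg (i, t'.+1))) o ms.
    case=> // i; have /and5P[_ _ _ _ /andP[+ _]] := inn i t'.
    by rewrite pp orbF bit_col ctl_row.
  have ms : forall i r, markc (sg (i, t)) r = (i == s t r).
    elim: t => [|t IH]; last by have [] := next t IH.
    case=> [|i] r; rewrite init_mark.
      by have [_ /and5P[_ _ _ _ /eqP->]] := bot 0; rewrite ffunE.
    by have [_ /and5P[_ _ _ /eqP-> _]] := bot i; rewrite ffunE.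
  by have [] := next t ms.
have nx t : gnext (q t) (q t.+1) by have /and5P[_ + _ _ _] := inn 0 t.
exists O, q, s; split; first split=> //.
- by have [_ /and5P[_ _ + _ _]] := bot 0.
- by move=> t; have [_ [_ ?]] := marks t.
(* Otherwise the final cells would be among the cells marked by [rX] at times before [t], one for
   each time. *)
- move=> t; apply: contrapT => nu; apply: acc.
  apply: (@sub_finite_set _ _ ((fun u => (s u rX, u.+1)) @` `I_t)); last first.
    exact: finite_image.
  move=> [i [|u]] /=.
    have [-> _] := bot i; move=> /mapP[c _ e].
    by have := ltn_ord (enum_rank c); rewrite -/(enc c) -e ltnNge leq_addr.
  rewrite (sgP (i, u)) (mem_map enc_inj) mem_enum inE /= ctl_row.
  have [mu _] := marks u; rewrite mu => /andP[au /eqP->]; exists u => //=.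
  by rewrite ltnNge; apply/negP => tu; apply: nu; exists u.
move=> hm; move=> i j.
have /and5P[_ _ _ _ /andP[_]] := inn i.+1 j.
have /and5P[_ _ _ _ /andP[_]] := inn i j.
rewrite !ctl_row !(mode_const nx) hm /= => /andP[_ /implyP h2] /andP[/implyP h1 _].
split; first by apply/eqP; rewrite h1 // pp.
by move=> /eqP/h2/eqP.
Qed.
End MachineTiling.

(** * Computability of the reduction *)

Definition recursive k (f : k.-tuple nat -> nat) :=
  exists c : recfun k, forall v, rf_eval c v (f v).

Section Recursive.
Variable k : nat.
Implicit Types f g : k.-tuple nat -> nat.

Lemma recursive_proj (i : 'I_k) : recursive (fun v => tnth v i).
Proof. by exists (rf_proj i). Qed.

Lemma recursive_comp1 (h : 1.-tuple nat -> nat) f :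
  recursive h -> recursive f -> recursive (fun v => h [tuple f v]).
Proof.
move=> [ch hP] [cf fP]; exists (rf_comp ch (fun _ => cf)) => v /=.
by exists [tuple f v]; split=> // i; rewrite (ord1 i).
Qed.

Lemma recursive_comp2 (h : 2.-tuple nat -> nat) f g :
  recursive h -> recursive f -> recursive g ->
  recursive (fun v => h [tuple f v; g v]).
Proof.
move=> [ch hP] [cf fP] [cg gP].
exists (rf_comp ch (tnth [tuple cf; cg])) => v /=.
exists [tuple f v; g v]; split=> // i.
by case: i => [[|[|]]] // lt; rewrite !(tnth_nth 0, tnth_nth cf).
Qed.

Lemma recursiveS f : recursive f -> recursive (fun v => (f v).+1).
Proof.
move=> fP; apply: (recursive_comp1 (h := fun v => (thead v).+1)) fP.
by exists rf_succ.
Qed.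

Lemma recursive_const n : recursive (fun _ : k.-tuple nat => n).
Proof.
elim: n => [|n]; last exact: recursiveS.
exists (rf_comp rf_zero (fun i : 'I_0 => match notF (ltn_ord i) with end)) => v /=.
by exists [tuple]; split=> // -[].
Qed.
End Recursive.

Lemma recursive_prec1 (n : nat) (h : 2.-tuple nat -> nat) (f : nat -> nat) :
  recursive h -> f 0 = n -> (forall i, f i.+1 = h [tuple i; f i]) ->
  recursive (fun v : 1.-tuple nat => f (thead v)).
Proof.
move=> [ch hP] f0 fS; have [cn nP] := recursive_const 0 n.
exists (rf_prec cn ch) => v /=; case/tupleP: v => x v; rewrite (tuple0 v).
exists f; split=> // [|i _]; first by rewrite f0; exact: nP.
rewrite fS; set w := (w in rf_eval _ w _).
by have -> : w = [tuple i; f i]; [exact: val_inj | exact: hP].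
Qed.

Lemma recursive_prec2 (g : 1.-tuple nat -> nat) (h : 3.-tuple nat -> nat)
    (f : nat -> nat -> nat) :
  recursive g -> recursive h -> (forall y, f 0 y = g [tuple y]) ->
  (forall i y, f i.+1 y = h [tuple i; f i y; y]) ->
  recursive (fun v : 2.-tuple nat => f (tnth v ord0) (tnth v ord_max)).
Proof.
move=> [cg gP] [ch hP] f0 fS.
exists (rf_prec cg ch) => v /=; case/tupleP: v => x v; case/tupleP: v => y v.
rewrite (tuple0 v) !(tnth_nth 0) /=.
exists (f ^~ y); split=> // [|i _].
  rewrite f0; set w := (w in rf_eval _ w _).
  by have -> : w = [tuple y]; [exact: val_inj | exact: gP].
rewrite fS; set w := (w in rf_eval _ w _).
by have -> : w = [tuple i; f i y; y]; [exact: val_inj | exact: hP].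
Qed.

Section RecursiveArithmetic.
Variable k : nat.
Implicit Types f g : k.-tuple nat -> nat.

Lemma recursiveD f g :
  recursive f -> recursive g -> recursive (fun v => f v + g v).
Proof.
apply: (recursive_comp2 (h := fun v => tnth v ord0 + tnth v ord_max)).
apply: (recursive_prec2 (f := addn) (recursive_proj ord0)
  (recursiveS (recursive_proj (Ordinal (isT : 1 < 3))))) => //.
Qed.
End RecursiveArithmetic.

Section RecursiveCode.
Variable k : nat.
Implicit Types f g : k.-tuple nat -> nat.

Lemma recursiveM f g :
  recursive f -> recursive g -> recursive (fun v => f v * g v).
Proof.
apply: (recursive_comp2 (h := fun v => tnth v ord0 * tnth v ord_max)).
apply: (recursive_prec2 (f := muln) (recursive_const 1 0)
  (recursiveD (recursive_proj ord_max)
     (recursive_proj (Ordinal (isT : 1 < 3))))) => // i y.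
Qed.

Lemma recursive_exp2 f : recursive f -> recursive (fun v => 2 ^ f v).
Proof.
apply: (recursive_comp1 (h := fun v => 2 ^ thead v)).
apply: (recursive_prec1 (n := 1) (f := expn 2) (recursiveD (recursive_proj ord_max)
     (recursive_proj ord_max))) => // i.
by rewrite !(tnth_nth 0) /= expnS mul2n addnn.
Qed.

Definition code_cons n m := 2 ^ n * m.*2.+1.

Lemma recursive_cons f g :
  recursive f -> recursive g -> recursive (fun v => code_cons (f v) (g v)).
Proof.
move=> fP gP; have := recursiveM (recursive_exp2 fP) (recursiveS (recursiveD gP gP)).
by congr recursive; apply/funext => v; rewrite /code_cons -addnn.
Qed.
End RecursiveCode.

Section MachineIndexComputable.
Variables (I G : finType) (glab : G -> act I) (gnext : rel G).
Variables (gstart gacc gmode : pred G).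
Local Notation cell := (cell I G).
Local Notation K := #|[the finType of cell]|.
Local Notation index := (machine_index glab gnext gstart gacc gmode).

Definition tiles_code (ts : seq (tile bool nat)) := CodeSeq.code (map ntile_code ts).

Lemma recursive_bottom_tiles k (r a : k.-tuple nat -> nat)
    (us : seq ((option bool * cell) * (option bool * cell))) :
  recursive r -> recursive a ->
  recursive (fun v => foldr code_cons (a v)
    (map ntile_code [seq bottom_tile (r v).+1 u | u <- us])).
Proof.
move=> rP aP; elim: us => [|u us IH] //=.
apply: (recursive_cons (f := fun v => ntile_code (bottom_tile (r v).+1 u))) IH.
have : recursive (fun v : k.-tuple nat =>
  code_cons (symbol_code u.1.1) (code_cons (enc u.1.2)
  (code_cons (symbol_code u.2.1) (code_cons (enc u.2.2)
  (code_cons 0 (code_cons (K + (r v).+1)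
  (code_cons 0 (code_cons (K + r v) 0)))))))).
  have c n : recursive (fun _ : k.-tuple nat => n) := recursive_const k n.
  have rS := recursiveS rP.
  have cr := recursiveD (c K) rP; have crS := recursiveD (c K) rS.
  by do !apply: recursive_cons.
by [].
Qed.

Lemma computable_machine_index : computable index.
Proof.
suff [c cP] : recursive (fun v : 1.-tuple nat => index (thead v)).
  by exists c => n; exact: cP.
have idP : recursive (fun v : 1.-tuple nat => thead v) := recursive_proj ord0.
have SP : recursive (fun v : 1.-tuple nat => (thead v).+1) := recursiveS idP.
(* Each increment of [n] prepends a fixed number of tiles in which only the countdown states
   vary. *)
have rowP : recursive (fun v : 1.-tuple nat =>
    tiles_code (row_tiles glab gnext gstart gmode (thead v))).
  pose us := enum (bottom (I := I) gstart false false).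
  apply: (@recursive_prec1 _ (fun v => foldr code_cons (tnth v ord_max)
    (map ntile_code [seq bottom_tile (tnth v ord0).+2 u | u <- us]))
    (fun n => tiles_code (row_tiles glab gnext gstart gmode n))) => //.
    exact: recursive_bottom_tiles (recursiveS (recursive_proj ord0))
      (recursive_proj ord_max).
  by move=> i; rewrite /tiles_code map_cat /CodeSeq.code foldr_cat.
have := recursive_cons (recursiveD (recursive_const 1 K) (recursiveS (recursiveS SP)))
  (recursive_cons (recursive_const 1 (CodeSeq.code (final_cells I gacc)))
  (recursive_bottom_tiles (enum (bottom (I := I) gstart true false)) SP rowP)).
congr recursive; apply/funext => v.
by rewrite /machine_index /machine_tiles map_cat /tiles_code /CodeSeq.code /= foldr_cat.
Qed.

(** The number of states, listed first in the index, determines [n]. *)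
Lemma machine_index_inj : injective index.
Proof.
by move=> n n' /(can_inj CodeSeq.codeK) [] /addnI [].
Qed.

End MachineIndexComputable.

(** * The reduction *)

Section TwoLoops.
Variables (I : finType) (r1 r2 : npos I).
Local Notation C1 := (ctl (Star (check r1))).
Local Notation C2 := (ctl (Star (check r2))).
Local Notation G := (C1 + C2)%type.

Definition choice_lab (c : G) : act I :=
  match c with inl c => loop_lab c | inr c => loop_lab c end.

(** No transition joins the two loops, so the initial state fixes the mode for ever. *)
Definition choice_next : rel G := fun c d =>
  match c, d with
  | inl c, inl d => cnext c d
  | inr c, inr d => cnext c d
  | _, _ => false
  end.

Definition choice_start : pred G := fun c =>
  match c with
  | inl c => c == Some (entry (check r1))
  | inr c => c == Some (entry (check r2))
  end.

Definition choice_acc : pred G := fun c =>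
  match c with inl c => c == None | inr c => c == None end.

Definition choice_mode : pred G := fun c => if c is inr _ then true else false.

Lemma choice_mode_next c d : choice_next c d -> choice_mode c = choice_mode d.
Proof. by case: c d => c [d|d]. Qed.

Local Notation run_of := (machine_run choice_lab choice_next choice_start choice_acc).

Lemma choice_runP N (b : bool) :
  (exists O q s, run_of N O q s /\ choice_mode (q 0) = b) <->
  exists w, forall x, rsat w N x (if b then r2 else r1).
Proof.
split=> [[O [q [s [[q0 s0 st acc] qb]]]]|[w wP]].
  exists O; case: b qb => qb.
    apply: (@loop_run_sound _ _ r2 N (fun t => if q t is inr c then c else None) s).
    have qE t : exists c, q t = inr c.
      elim: t => [|t [c qt]]; first by case: (q 0) qb => // c; exists c.
      by have [_] := st t; rewrite qt; case: (q t.+1) => // d; exists d.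
    split=> // [|t|t].
    - by have [c qc] := qE 0; move: q0; rewrite qc => /eqP.
    - by have := st t; have [c ->] := qE t; have [d ->] := qE t.+1.
    - have [u [tu au]] := acc t; exists u; split=> //.
      by have [c qc] := qE u; move: au; rewrite qc => /eqP.
  apply: (@loop_run_sound _ _ r1 N (fun t => if q t is inl c then c else None) s).
  have qE t : exists c, q t = inl c.
    elim: t => [|t [c qt]]; first by case: (q 0) qb => // c; exists c.
    by have [_] := st t; rewrite qt; case: (q t.+1) => // d; exists d.
  split=> // [|t|t].
  - by have [c qc] := qE 0; move: q0; rewrite qc => /eqP.
  - by have := st t; have [c ->] := qE t; have [d ->] := qE t.+1.
  - have [u [tu au]] := acc t; exists u; split=> //.
    by have [c qc] := qE u; move: au; rewrite qc => /eqP.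
exists w; case: b wP => /loop_run_complete[q [s [q0 s0 st acc]]].
  exists (fun t => inr (q t)), s; split=> //; split=> //; first exact/eqP.
  by move=> t; have [u [tu qu]] := acc t; exists u; split=> //; exact/eqP.
exists (fun t => inl (q t)), s; split=> //; split=> //; first exact/eqP.
by move=> t; have [u [tu qu]] := acc t; exists u; split=> //; exact/eqP.
Qed.
End TwoLoops.

Lemma npos_map_sat (S S' : Type) (g : S -> S') (h : S' -> option S) N (p : npos S) :
  pcancel g h ->
  (exists f, forall x, nsat f N x (npos_map g p)) <-> (exists f, forall x, nsat f N x p).
Proof.
move=> gh; split=> -[f fP].
  have fE : {in npos_syms p, forall s, f (g s) = (f \o g) s} by [].
  by exists (f \o g) => x; apply/(nsat_map N x fE).
pose f' s' := if h s' is Some s then f s else id.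
have fE : {in npos_syms p, forall s, f' (g s) = f s} by move=> s _; rewrite /f' gh.
by exists f' => x; apply/(nsat_map N x fE).
Qed.

Theorem two_mode_reduction (A1 A2 : set nat) : Sigma11 A1 -> Sigma11 A2 ->
  exists f, [/\ computable f, injective f & forall n p,
    buchi_language (tiling_of_index (f n)) p <->
    is_picture p /\ (A1 n \/ (A2 n /\ stairs p))].
Proof.
move=> /Sigma11_normal_form[S1 [p1 p1P]] /Sigma11_normal_form[S2 [p2 p2P]].
have [k1 [q1 q1P]] := npos_finitize p1; have [k2 [q2 q2P]] := npos_finitize p2.
(* Each of the two programs gets its own tapes. *)
pose I : finType := ('I_k1.+1 + 'I_k2.+1)%type.
pose r1 : npos I := npos_map inl q1; pose r2 : npos I := npos_map inr q2.
have A1P n : A1 n <-> exists w, forall x, rsat w n.+2 x r1.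
  rewrite p1P q1P -nsat_oracle; apply: iff_sym.
  by apply: (npos_map_sat (h := fun i => if i is inl i then Some i else None)).
have A2P n : A2 n <-> exists w, forall x, rsat w n.+2 x r2.
  rewrite p2P q2P -nsat_oracle; apply: iff_sym.
  by apply: (npos_map_sat (h := fun i => if i is inr i then Some i else None)).
exists (machine_index (@choice_lab _ r1 r2) (@choice_next _ r1 r2)
  (@choice_start _ r1 r2) (@choice_acc _ r1 r2) (@choice_mode _ r1 r2)).
split; [exact: computable_machine_index | exact: machine_index_inj |].
move=> n p; split=> [lp|[pp]].
  have pp : is_picture p by case: lp.
  have [O [q [s [run st]]]] := tiling_machine_run (@choice_mode_next _ _ _) lp.
  split=> //; case E: (choice_mode (q 0)).
    right; split; last exact: st.
    by apply/A2P; apply/(choice_runP r1 r2 _ true); exists O, q, s.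
  by left; apply/A1P; apply/(choice_runP r1 r2 _ false); exists O, q, s.
have tilingP := machine_run_tiling (@choice_mode_next _ r1 r2) pp.
move=> [/A1P /(choice_runP r1 r2 _ false)|[/A2P /(choice_runP r1 r2 _ true) + st]].
  by move=> [O [q [s [run md]]]]; apply: tilingP run _; rewrite md.
by move=> [O [q [s [run md]]]]; exact: tilingP run _.
Qed.

(** * Cardinalities of the possible languages *)

Lemma uncountable_pictures :
  ~ countable [set p : nat * nat -> option bool | is_picture p].
Proof.
pose blank (v : nat * nat) := if (v.1 == 0) || (v.2 == 0) then None else Some true.
move=> /(countable_enum blank)[g gP].
(* Off the border, column [k.+1] differs from [g k] everywhere. *)
pose p (v : nat * nat) := if (v.1 == 0) || (v.2 == 0) then None
  else Some (g v.1.-1 v != Some true).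
have /gP[k gk] : is_picture p by move=> i j; rewrite /p /=; case: ifP.
have := congr1 (@^~ (k.+1, 1)) gk; rewrite /p /=.
by case: (g k _) => [[]|].
Qed.

(** The height [None] is infinite. *)
Definition stair (k : option nat) (v : nat * nat) : option bool :=
  if (v.1 == 0) || (v.2 == 0) then None
  else Some (if k is Some k then v.2 <= k else true).

Lemma stair_picture k : is_picture (stair k).
Proof. by move=> i j; rewrite /stair /=; case: ifP. Qed.

Lemma stairs_stair k : stairs (stair k).
Proof.
move=> i j; rewrite /stair /=; split=> //; case: k => // k [] /negbT.
by rewrite -ltnNge => /leqW; rewrite ltnNge => /negPf->.
Qed.

Lemma stairsP p : is_picture p -> stairs p -> exists k, p = stair k.
Proof.
move=> pp st.
have pE i j : p (i.+1, j.+1) = p (1, j.+1).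
  by elim: i => // i <-; case: (st i j).
have [k kP] : exists k, forall j, p (1, j.+1) = stair k (1, j.+1).
  have some j : p (1, j.+1) = Some true \/ p (1, j.+1) = Some false.
    by have := pp 1 j.+1; case: (p _) => // -[]; [left|right].
  have [[j0 j0P]|nj] := pselect (exists j, p (1, j.+1) == Some false); last first.
    exists None => j; case: (some j) => // e; case: nj; exists j; exact/eqP.
  have ex : exists j, p (1, j.+1) == Some false by exists j0.
  (* The minimum counts rows of letters from 0, but these start at 1: the first row of [Some false]
     is [k.+1], so the height is [k]. *)
  exists (Some (ex_minn ex)) => j; case: ex_minnP => k /eqP kF kmin.
  rewrite /stair /=; have [jk|kj] := ltnP j k.
    case: (some j) => // /eqP /kmin; rewrite leqNgt jk //.
  elim: j kj => [|j IH]; first by rewrite leqn0 => /eqP k0; rewrite k0 in kF.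
  rewrite leq_eqVlt => /orP[/eqP e|kj]; first by rewrite e in kF.
  by case: (st 0 j) => _; apply; exact: IH.
exists k; apply/funext => -[[|i] [|j]]; try by apply/eqP; rewrite pp.
by rewrite pE kP.
Qed.

Lemma countable_stairs :
  countable [set p : nat * nat -> option bool | is_picture p /\ stairs p].
Proof.
apply: (@sub_countable _ _ _ (range stair)).
  apply: subset_card_le => p [pp /stairsP]; move=> /(_ pp)[k ->].
  by exists k.
exact: sub_countable (card_image_le _ _) (countableP _).
Qed.

Lemma infinite_stairs :
  infinite_set [set p : nat * nat -> option bool | is_picture p /\ stairs p].
Proof.
apply/infiniteP; rewrite -(card_le_eql (inj_card_eq (f := fun k => stair (Some k)) _)).
  apply: subset_card_le => _ [k _ <-].
  by split; [exact: stair_picture | exact: stairs_stair].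
suff le k l : stair (Some k) = stair (Some l) -> k <= l.
  by move=> k l _ _ e; apply/eqP; rewrite eqn_leq !le.
case: k => // k /(congr1 (@^~ (1, k.+1))) [].
by rewrite leqnn => /esym.
Qed.

Lemma countably_infiniteP (T : Type) (A : set T) :
  (A #= [set: nat])%card <-> infinite_set A /\ countable A.
Proof.
rewrite card_eq_le infiniteP /countable.
by split=> [/andP[]|[-> ->]].
Qed.

Theorem theorem4p15 :
  [/\ complete_for Pi11
        [set z : nat | countable (buchi_language (tiling_of_index z))],
      complete_for Sigma11
        [set z : nat | ~ countable (buchi_language (tiling_of_index z))] &
      complete_for D2_Sigma11
        [set z : nat |
          (buchi_language (tiling_of_index z) #= [set: nat])%card]].
Proof.
have Pi11_countable :
  Pi11 [set z | countable (buchi_language (tiling_of_index z))].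
  exact: Sigma11_uncountable.
have uncountableP A : Sigma11 A -> exists f, [/\ computable f, injective f &
    forall n, ~ countable (buchi_language (tiling_of_index (f n))) <-> A n].
  (* With the same set in both modes, the language consists of all pictures if [n] is in [A] and is
     empty otherwise. *)
  move=> hA; have [f [cf injf fP]] := two_mode_reduction hA hA.
  exists f; split=> // n; split=> [|An cL].
    move=> ncL; apply: contrapT => nA; apply: ncL.
    suff -> : buchi_language (tiling_of_index (f n)) = set0 by exact: countable0.
    by apply/seteqP; split=> // p /fP [_ [|[]]].
  apply: uncountable_pictures; apply: sub_countable (subset_card_le _) cL.
  by move=> p pp; apply/fP; split=> //; left.
split; split.
- exact: Pi11_countable.
- move=> B /uncountableP[f [cf injf fP]]; exists f; split=> //.
  apply/seteqP; split=> n /=; have [fP1 fP2] := fP n.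
    by move=> Bn; apply: contrapT => /fP1.
  by move=> cL; apply: contrapT => /fP2.
- exact: Sigma11_uncountable.
- move=> B /uncountableP[f [cf injf fP]]; exists f; split=> //.
  by apply/seteqP; split=> n /fP.
- exists [set z | infinite_set (buchi_language (tiling_of_index z))].
  exists [set z | countable (buchi_language (tiling_of_index z))].
  split=> //; first exact: Sigma11_infinite.
  by apply/seteqP; split=> z /countably_infiniteP.
- move=> _ [B [C [hB hC ->]]].
  (* The complement of [C] governs the free mode: outside [C] the language is uncountable, on [C] it
     is the countably infinite set of stairs or empty according to [B]. *)
  have [f [cf injf fP]] := two_mode_reduction hC hB.
  exists f; split=> //; apply/seteqP; split=> n.
    move=> [Bn Cn]; apply/countably_infiniteP.
    suff -> : buchi_language (tiling_of_index (f n)) =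
        [set p | is_picture p /\ stairs p].
      by split; [exact: infinite_stairs | exact: countable_stairs].
    apply/seteqP; split=> p; first by move=> /fP[pp [|[]]].
    by move=> [pp st]; apply/fP; split=> //; right.
  move=> /countably_infiniteP[infL cL].
  have Cn : C n.
    apply: contrapT => nC; apply: uncountable_pictures.
    apply: sub_countable (subset_card_le _) cL => p pp.
    by apply/fP; split=> //; left.
  split=> //; apply: contrapT => nB; apply: infL.
  suff -> : buchi_language (tiling_of_index (f n)) = set0 by exact: finite_set0.
  by apply/seteqP; split=> // p /fP [_ [|[]]].
Qed.
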